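(* Let $\{X_n:n\ge0\}$ be a discrete time random walk with jump range $R$ in a uniformly elliptic time-dependent random environment $\omega$ on $\mathbb{Z}^d$ (as defined in the context), with environmental process satisfying assumption (ED). Assume that either (i) $R$ is finite, convex, symmetric and there is a neighborhood of $0$ which belongs to the convex hull of $R$; or (ii) $R$ corresponds to the nearest neighbor case, i.e. $R=\{e\in\mathbb{Z}^d:|e|_1=1\}$. Let $R_1=R$, $R_{n+1}=\{y\in\mathbb{Z}^d:y=x+e\text{ for some }x\in R_n,\ e\in R\}$ for $n\ge1$, $U_n=R_n/n$, and $$U=\{x\in\mathbb{R}^d:x=\lim_{n\to\infty}x_n\text{ for some sequence }x_n\in U_n\}.$$ Then $U$ equals the convex hull of $R$, and there exists a convex rate function $I_d:\mathbb{R}^d\to[0,\infty]$ such that $I_d(x)\le|\log\kappa|$ for $x\in U$, $I_d(x)=\infty$ for $x\notin U$, $I_d$ is continuous at every $x$ in the interior $U^o$ of $U$, and the following hold. (i) For every open set $O\subset\mathbb{R}^d$, $Q_\mu^d$-a.s. $$\liminf_{n\to\infty}\frac1n\log P_{0,\omega}^d\left(\frac{X_n}{n}\in O\right)\ge-\inf_{x\in O}I_d(x).$$ (ii) For every closed set $C\subset\mathbb{R}^d$, $Q_\mu^d$-a.s. $$\limsup_{n\to\infty}\frac1n\log P_{0,\omega}^d\left(\frac{X_n}{n}\in C\right)\le-\inf_{x\in C}I_d(x).$$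
   Context: Environment. Fix $d\ge1$, $\kappa>0$ and a finite set $R\subset\mathbb{Z}^d$. Let $\mathcal{P}=\{v=\{v(e):e\in R\}:\inf_{e\in R}v(e)\ge\kappa,\ \sum_{e\in R}v(e)=1\}$ and $\Omega_d=\mathcal{P}^{\mathbb{Z}^d}$. The discrete time environmental process is a discrete time Markov process $\omega=\{\omega_n:n\ge0\}$ with state space $\Omega_d$, $\omega_n=\{\omega_n(x):x\in\mathbb{Z}^d\}$, $\omega_n(x)=\{\omega_n(x,e):e\in R\}\in\mathcal{P}$; for each initial condition $\eta\in\Omega_d$, $Q^d_\eta$ denotes its law on $\Omega_d^{\mathbb{N}}$ (time indices $n\ge0$). $\mu$ is a probability measure on $\Omega_d$ invariant for this Markov process (i.e. $\int E_{Q^d_\eta}[f(\omega_n)]\,d\mu(\eta)=\int f\,d\mu$ for bounded continuous $f$ and $n\ge0$) and invariant under space translations. Set $Q^d_\mu=\int Q^d_\eta\,d\mu(\eta)$. Random walk. For a given $\omega\in\Omega_d^{\mathbb{N}}$, $P^d_{x,\omega}$ is the law on $(\mathbb{Z}^d)^{\mathbb{N}}$ of the Markov chain $\{X_n:n\ge0\}$ with $P^d_{x,\omega}(X_0=x)=1$ and $P^d_{x,\omega}(X_{n+1}=y+e\mid X_n=y)=\omega_n(y,e)$ for $n\ge0$, $y\in\mathbb{Z}^d$, $e\in R$ (the quenched law). A subset $A\subset\mathbb{Z}^d$ is called convex if $A=V\cap\mathbb{Z}^d$ for some convex $V\subset\mathbb{R}^d$, and symmetric if $A=-A$. The convex hull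 of $R$ is taken in $\mathbb{R}^d$. Assumption (ED). For $x\in\mathbb{Z}^d$ define $T_{1,x}:\Omega_d^{\mathbb{N}}\to\Omega_d^{\mathbb{N}}$ by $(T_{1,x}\omega)_n(y)=\omega_{n+1}(y+x)$. The family $\{T_{1,x}:x\in R\}$ is an ergodic family of (measure preserving) transformations on $(\Omega_d^{\mathbb{N}},\mathcal{B}(\Omega_d^{\mathbb{N}}),Q^d_\mu)$: whenever $A\in\mathcal{B}(\Omega_d^{\mathbb{N}})$ satisfies $T_{1,x}^{-1}A=A$ for every $x\in R$, then $Q^d_\mu(A)\in\{0,1\}$. *)

(* Defs.v *)
From HB Require Import structures.
From mathcomp Require Import all_boot all_order all_algebra finmap.
From mathcomp Require Import all_classical all_reals all_analysis.

Set Implicit Arguments.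
Unset Strict Implicit.
Unset Printing Implicit Defensive.
Import Order.TTheory GRing.Theory Num.Theory.
Import numFieldNormedType.Exports.
Local Open Scope classical_set_scope.
Local Open Scope ring_scope.

Notation borelType T := (g_sigma_algebraType (@open T)).

Section lattice.
Context {R : realType} {d : nat}.
Implicit Types (J : {fset 'rV[int]_d}) (A : set 'rV[int]_d).

Definition embed (x : 'rV[int]_d) : 'rV[R]_d := map_mx intr x.

Definition convex_hull (A : set 'rV[R]_d) : set 'rV[R]_d :=
  smallest (fun V : set 'rV[R]_d => convex_set V) A.

Definition lattice_convex A :=
  exists2 V : set 'rV[R]_d, convex_set V & A = [set z | V (embed z)].

Definition lattice_symmetric A := A = [set - z | z in A].

Definition nearest_neighbor J :=
  forall e : 'rV[int]_d, (e \in J) = (\sum_(i < d) `|e ord0 i| == 1).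

(* The value at index 0 is junk. *)
Fixpoint reach J (n : nat) : set 'rV[int]_d :=
  match n with
  | 0 | 1 => [set` J]
  | m.+1 => [set y | exists x e, [/\ reach J m x, e \in J & y = x + e]]
  end.

Definition scaled_reach J (n : nat) : set 'rV[R]_d :=
  [set n%:R^-1 *: embed y | y in reach J n].

Definition limit_shape J : set 'rV[R]_d :=
  [set x | exists x_ : nat -> 'rV[R]_d,
     (forall n, (0 < n)%N -> scaled_reach J n (x_ n)) /\ (x_ @ \oo --> x)].

End lattice.

Section environment.
Context {R : realType} {d : nat}.

Definition elliptic_simplex (J : {fset 'rV[int]_d}) (kappa : R)
    : set {ptws J -> R} :=
  [set v | (forall e, kappa <= v e) /\ \sum_(e : J) v e = 1].
Arguments elliptic_simplex J kappa _ : clear implicits.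

(* Measurable types are nonempty, hence the argument [ne]. It loses nothing:
   if the simplex is empty then so is the environment space, which then carries
   no probability measure. *)
Definition site_law (J : {fset 'rV[int]_d}) (kappa : R)
    (ne : elliptic_simplex J kappa !=set0) : Type :=
  set_type (elliptic_simplex J kappa).

Section instances.
Variables (J : {fset 'rV[int]_d}) (kappa : R).
Variable ne : elliptic_simplex J kappa !=set0.

HB.instance Definition _ := Topological.on (site_law ne).

Let default_site_law : site_law ne := SigSub (mem_set (projT2 (cid ne))).
HB.instance Definition _ := isPointed.Build (site_law ne) default_site_law.
End instances.

Definition env (J : {fset 'rV[int]_d}) (kappa : R)
    (ne : elliptic_simplex J kappa !=set0) : Type :=
  {ptws 'rV[int]_d -> site_law ne}.

Section env_instances.
Variables (J : {fset 'rV[int]_d}) (kappa : R).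
Variable ne : elliptic_simplex J kappa !=set0.

HB.instance Definition _ := Topological.on (env ne).
HB.instance Definition _ :=
  isPointed.Build (env ne) (fun _ => point : site_law ne).

Definition env_path : Type := {ptws nat -> env ne}.
HB.instance Definition _ := Topological.on env_path.
HB.instance Definition _ := isPointed.Build env_path (fun _ => point : env ne).
End env_instances.

Section process.
Variables (J : {fset 'rV[int]_d}) (kappa : R).
Variable ne : elliptic_simplex J kappa !=set0.
Local Notation Omega := (borelType (env ne)).
Local Notation OmegaN := (borelType (env_path ne)).

Definition jump_prob (w : env_path ne) (n : nat) (y : 'rV[int]_d) (e : J) : R :=
  set_val (w n y) e.

Definition history (n : nat) : set_system (env_path ne) :=
  <<s [set A | exists i (B : set Omega),
        [/\ (i <= n)%N, measurable B & A = [set w | B (w i)]]] >>.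

(* [Q eta] is the law of the time-homogeneous Markov chain with transition
   kernel [p] started at [eta]. *)
Definition markov_laws (p : R.-pker Omega ~> Omega)
    (Q : R.-pker Omega ~> OmegaN) :=
  (forall eta, Q eta [set w | w 0%N = eta] = 1%E) /\
  (forall eta n (F : set OmegaN) (B : set Omega),
     history n F -> measurable B ->
     Q eta (F `&` [set w | B (w n.+1)]) = (\int[Q eta]_(w in F) p (w n) B)%E).

Definition invariant_law (Q : R.-pker Omega ~> OmegaN)
    (mu : probability Omega R) :=
  forall f : env ne -> R, continuous f ->
    (exists M : R, forall eta, `|f eta| <= M) ->
    forall n : nat,
      (\int[mu]_eta \int[Q eta]_w (f (w n))%:E = \int[mu]_eta (f eta)%:E)%E.

Definition env_translate (x : 'rV[int]_d) (eta : env ne) : env ne :=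
  fun y => eta (y + x).

Definition translation_invariant (mu : probability Omega R) :=
  forall (x : 'rV[int]_d) (A : set Omega), measurable A ->
    mu (env_translate x @^-1` A) = mu A.

Section annealed.
Variables (mu : probability Omega R) (Q : R.-pker Omega ~> OmegaN).

Definition annealed (A : set OmegaN) : \bar R := (\int[mu]_eta Q eta A)%E.

Let annealed0 : annealed set0 = 0%E.
Proof. by apply: integral0_eq => eta _; rewrite measure0. Qed.

Let annealed_ge0 A : (0 <= annealed A)%E.
Proof. by apply: integral_ge0 => eta _; exact: measure_ge0. Qed.

Let annealed_sigma_additive : semi_sigma_additive annealed.
Proof.
move=> F mF tF mUF; rewrite [X in _ --> X](_ : _ =
    (\sum_(0 <= n <oo) annealed (F n))%E); last first.
  rewrite /annealed -integral_nneseries//; last first.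
    by move=> n; exact: measurable_kernel.
  by apply: eq_integral => eta _; rewrite measure_semi_bigcup.
by apply: is_cvg_nneseries => n _ _; exact: annealed_ge0.
Qed.

HB.instance Definition _ := isMeasure.Build _ _ _ annealed
  annealed0 annealed_ge0 annealed_sigma_additive.

Let annealedT : annealed setT = 1%E.
Proof.
rewrite /annealed; under eq_integral do rewrite prob_kernel.
rewrite integral_cst// mul1e; exact: probability_setT.
Qed.

HB.instance Definition _ := Measure_isProbability.Build _ _ _ annealed annealedT.

End annealed.

Definition env_shift (x : 'rV[int]_d) (w : env_path ne) : env_path ne :=
  fun n y => w n.+1 (y + x).

Definition ergodic_shifts (Qmu : probability OmegaN R) :=
  (forall x, x \in J -> forall A : set OmegaN, measurable A ->
     Qmu (env_shift x @^-1` A) = Qmu A) /\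
  (forall A : set OmegaN, measurable A ->
     (forall x, x \in J -> env_shift x @^-1` A = A) ->
     Qmu A = 0%E \/ Qmu A = 1%E).

Definition walk_path : Type := nat -> 'rV[int]_d.
HB.instance Definition _ := Choice.copy walk_path (nat -> 'rV[int]_d).
HB.instance Definition _ := isPointed.Build walk_path (fun _ => 0).

Definition walk_cylinders : set_system walk_path :=
  [set A | exists n x, A = [set X | X n = x]].

Definition quenched_law (w : env_path ne) (x : 'rV[int]_d)
    (P : probability (g_sigma_algebraType walk_cylinders) R) :=
  P [set X | X 0%N = x] = 1%E /\
  (forall n (s : nat -> 'rV[int]_d) (e : J),
     P [set X | (forall i, (i <= n)%N -> X i = s i) /\ X n.+1 = s n + val e] =
     (P [set X | forall i, (i <= n)%N -> X i = s i]
       * (jump_prob w n (s n) e)%:E)%E).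

End process.
End environment.
Arguments elliptic_simplex {R d} J kappa _.

Section ldp.
Context {R : realType} {d : nat}.

Definition convex_rate_function (I : 'rV[R]_d -> \bar R) :=
  [/\ forall x, (0 <= I x)%E, lower_semicontinuous I &
      forall x y (t : R), 0 <= t <= 1 ->
        (I (t *: x + (1 - t) *: y)%R <= t%:E * I x + (1 - t)%:E * I y)%E].

Definition log_prob_rate
    (P : probability (g_sigma_algebraType (@walk_cylinders d)) R)
    (A : set 'rV[R]_d) (n : nat) : \bar R :=
  ((n%:R^-1)%:E * lne (P [set X | A (n%:R^-1 *: embed (X n))]))%E.

End ldp.

(* Main.v *)
Require Import Defs.
From mathcomp Require Import all_boot all_order all_algebra finmap.
From mathcomp Require Import all_classical all_reals all_analysis.
From mathcomp Require Import measurable_realfun ring lra zify.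
Set Implicit Arguments.
Unset Strict Implicit.
Unset Printing Implicit Defensive.
Import Order.TTheory GRing.Theory Num.Theory.
Import numFieldNormedType.Exports.
Local Open Scope classical_set_scope.
Local Open Scope ring_scope.

(* Write p_w(n, y) for the quenched probability that the walk sits at y at time n.
   For a lattice vector u reachable in k steps, p_w(n k, n u) is supermultiplicative
   along the shift by (k, u); that shift need not be ergodic on its own, but if u / k is
   interior to the hull of the jump range then ellipticity makes the limsup of
   (1/n) log p_w(n k, n u) invariant under every one-step shift, hence almost surely
   constant.  A greedy decomposition into blocks realising this limsup, together with
   the maximal inequality for the visits to the bad set, shows that the limsup is a limit.
   The rate function is the lower semicontinuous envelope of these rates over the interior
   rational velocities.  The upper bound follows from compactness of the hull, because all
   points near n x can be steered to one point on a ray of velocity close to x within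
   a small multiple of n steps.  Only two features of the jump range enter: it is
   symmetric and its hull is a neighbourhood of the origin; parity and sublattice
   constraints are absorbed by asking only for points that are reachable at some time of
   the right parity. *)

(** * Hulls and reachable points *)

(** The quenched laws come one environment at a time, with no measurability in [w]. The ergodic
    estimates are therefore made on [walk_prob], a finite recursion continuous in [w], and are
    transferred at the end by comparisons valid for each single [w]. A rate is attached to a pair
    [(k, u)] rather than to the real velocity [u / k]: at the times [n * k] the target [u *+ n] is
    always reachable, so its probability is positive and its logarithm superadditive whatever the
    parity. The pairs are countable, so one null set serves all of them, and with them all open and
    all closed sets. Boundary points of the hull receive a rate only through the envelope. *)

Section shull_theory.
Context {R : realType} {V : normedModType R}.

(** For [r >= 0] this is [r] times the convex hull of the generators and the origin. Allowing total
    weight below [r] makes it monotone in [r], like the sublevel sets of a gauge. For a nonempty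
    symmetric jump range the slack changes nothing, since opposite jumps cancel. *)
Definition scaled_hull (I : eqType) (s : seq I) (f : I -> V) (r : R) (x : V) :=
  exists a : I -> R, [/\ forall e, 0 <= a e, \sum_(e <- s) a e <= r &
    x = \sum_(e <- s) a e *: f e].

Variables (I : eqType) (s : seq I) (f : I -> V).
Local Notation shull := (scaled_hull s f).

Lemma shull0 r : 0 <= r -> shull r 0.
Proof.
move=> r0; exists (fun=> 0); split => //; first by rewrite big1.
by rewrite big1// => e _; rewrite scale0r.
Qed.

Lemma shull_le r r' x : r <= r' -> shull r x -> shull r' x.
Proof. by move=> rr [a [a0 ar ->]]; exists a; split => //; exact: le_trans rr. Qed.

Lemma shullD r r' x y : shull r x -> shull r' y -> shull (r + r') (x + y).
Proof.
move=> [a [a0 ar ->]] [b [b0 br ->]]; exists (fun e => a e + b e); split.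
- by move=> e; rewrite addr_ge0.
- by rewrite big_split/= lerD.
- by rewrite -big_split/=; apply: eq_bigr => e _; rewrite scalerDl.
Qed.

Lemma shullZ t r x : 0 <= t -> shull r x -> shull (t * r) (t *: x).
Proof.
move=> t0 [a [a0 ar ->]]; exists (fun e => t * a e); split.
- by move=> e; rewrite mulr_ge0.
- by rewrite -mulr_sumr ler_wpM2l.
- by rewrite scaler_sumr; apply: eq_bigr => e _; rewrite scalerA.
Qed.

Lemma shull_gen e : uniq s -> e \in s -> shull 1 (f e).
Proof.
move=> us es; exists (fun e' => (e' == e)%:R); split => //.
- rewrite (bigD1_seq e)//= eqxx big1 ?addr0// => e' /negbTE ->//.
- by rewrite (bigD1_seq e)//= eqxx scale1r big1 ?addr0// => e' /negbTE ->; rewrite scale0r.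
Qed.

Lemma shull_sum (K : Type) (t : seq K) (r : K -> R) (x : K -> V) :
  (forall k, shull (r k) (x k)) -> shull (\sum_(k <- t) r k) (\sum_(k <- t) x k).
Proof.
by move=> H; elim/big_ind2 : _ => //; [exact: shull0|move=> *; exact: shullD].
Qed.

Lemma shull_ge0 r x : shull r x -> 0 <= r.
Proof. by move=> [a [a0 + _]]; apply: le_trans; exact: sumr_ge0. Qed.

End shull_theory.

Section shull_cons.
Context {R : realType} {V : normedModType R} {I : eqType} (f : I -> V).

Lemma shull_nil x : scaled_hull [::] f 1 x <-> x = 0.
Proof.
split=> [[a [_ _ ->]]|->]; first by rewrite big_nil.
exact: shull0.
Qed.

(** Peeling off one generator turns a long convex combination into iterated two-point ones, so that
    compactness and minimality of the hull follow by induction on the list. *)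
Lemma shull_cons e s x : e \notin s -> scaled_hull (e :: s) f 1 x <->
  exists t y, [/\ 0 <= t <= 1, scaled_hull s f 1 y & x = t *: f e + (1 - t) *: y].
Proof.
move=> es; split=> [[a [a0 a1 ->]]|[t [y [/andP[t0 t1] [a [a0 a1 ->]] ->]]]].
  rewrite !big_cons in a1 *.
  have s0 : 0 <= \sum_(j <- s) a j by exact: sumr_ge0.
  exists (a e).
  (* The other weights are renormalised by [1 - a e]; when this is zero they all vanish. *)
  have [ae1|ae1] := eqVneq (a e) 1.
    exists 0; split; [by rewrite ae1 lexx ler01|exact: shull0|].
    rewrite ae1 subrr scale0r; congr (_ + _); rewrite big_seq big1// => j js.
    suff -> : a j = 0 by rewrite scale0r.
    apply/eqP; rewrite eq_le a0 andbT.
    have : \sum_(j <- s) a j <= 0 by lra.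
    apply: le_trans; rewrite (big_rem j)//= lerDl; exact: sumr_ge0.
  have lt1 : 0 < 1 - a e by rewrite subr_gt0 lt_neqAle ae1; lra.
  exists ((1 - a e)^-1 *: \sum_(j <- s) a j *: f j); split.
  - by rewrite a0; lra.
  - exists (fun j => (1 - a e)^-1 * a j); split.
    + by move=> j; rewrite mulr_ge0// invr_ge0 ltW.
    + by rewrite -mulr_sumr mulrC ler_pdivrMr// mul1r; lra.
    + by rewrite scaler_sumr; apply: eq_bigr => j _; rewrite scalerA.
  - by rewrite scalerA divff ?scale1r// gt_eqF.
exists (fun j => if j == e then t else (1 - t) * a j); split.
- by move=> j; case: ifP => // _; rewrite mulr_ge0// subr_ge0.
- rewrite big_cons eqxx big_seq; under eq_bigr => j js.
    have -> : (j == e) = false by apply/negbTE; apply: contraNneq es => <-.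
    over.
  rewrite -big_seq -mulr_sumr -lerBrDl ler_piMr// subr_ge0//.
rewrite big_cons eqxx scaler_sumr; congr (_ + _).
rewrite [LHS]big_seq [RHS]big_seq; apply: eq_bigr => j js.
have -> : (j == e) = false by apply/negbTE; apply: contraNneq es => <-.
by rewrite scalerA.
Qed.

Lemma shull_compact s : uniq s -> compact (scaled_hull s f 1).
Proof.
elim: s => [_|e s IH /= /andP[es us]].
  rewrite (_ : scaled_hull _ _ _ = [set 0]); first exact: compact_set1.
  by apply/seteqP; split => x /shull_nil.
rewrite (_ : scaled_hull _ _ _ =
    (fun p : R * V => p.1 *: f e + (1 - p.1) *: p.2) @` (`[0, 1] `*` scaled_hull s f 1)).
  apply: continuous_compact.
    apply: continuous_subspaceT => p; apply: cvgD.
      by apply: cvgZl; exact: cvg_fst.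
    apply: cvgZ; last exact: cvg_snd.
    by apply: cvgB; [exact: cvg_cst|exact: cvg_fst].
  by apply: compact_setX; [exact: segment_compact|exact: IH].
apply/seteqP; split => x.
  move=> /(shull_cons x es)[t [y [t01 sy ->]]]; exists (t, y) => //=.
move=> [[t y] [/=]]; rewrite in_itv /= => t01 sy <-.
by apply/(shull_cons _ es); exists t, y.
Qed.

Lemma shull_sub_convex s (A : set (convex_lmodType V)) : uniq s -> convex_set A -> A 0 ->
  (forall e, e \in s -> A (f e)) -> scaled_hull s f 1 `<=` A.
Proof.
move=> + cA A0; elim: s => [_ _ x /shull_nil ->//|e s IH /= /andP[es us] As x].
move=> /(shull_cons x es)[t [y [t01 sy ->]]].
have Ay : A y by apply: IH sy => // j js; apply: As; rewrite inE js orbT.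
have Ae : A (f e) by apply: As; rewrite inE eqxx.
have t01' : Itv.spec (@Itv.num_sem R) (Itv.Real `[0%Z, 1%Z]) t.
  by rewrite /= /Itv.num_sem /= in_itv /= t01 andbT num_real.
have := cA (f e) y (Itv.mk t01'); rewrite !inE; exact.
Qed.

End shull_cons.

(** Source of the bounded delay in [nstep_control]: finitely many cases have a largest chosen
    witness. *)
Lemma uniform_witness_bound (I : finType) (A : I -> nat -> Prop) :
  exists K, forall i, (exists m, A i m) -> exists2 m, (m <= K)%N & A i m.
Proof.
have /choice[g gA] i : exists m, (exists m, A i m) -> A i m.
  by have [[m Am]|nA] := pselect (exists m, A i m); [exists m|exists 0%N].
exists (\max_i g i) => i Ai; exists (g i); first exact: leq_bigmax.
exact: gA.
Qed.

Section embed.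
Context {R : realType} {d : nat}.
Local Notation embed := (@embed R d).

Lemma embed0 : embed 0 = 0. Proof. by apply/matrixP => i j; rewrite !mxE. Qed.

Lemma embedD x y : embed (x + y) = embed x + embed y.
Proof. by apply/matrixP => i j; rewrite !mxE rmorphD. Qed.

Lemma embedN x : embed (- x) = - embed x.
Proof. by apply/matrixP => i j; rewrite !mxE rmorphN. Qed.

Lemma embedB x y : embed (x - y) = embed x - embed y.
Proof. by rewrite embedD embedN. Qed.

Lemma embedMn x n : embed (x *+ n) = n%:R *: embed x.
Proof. by apply/matrixP => i j; rewrite !mxE mulmxnE rmorphMn mulr_natl. Qed.

Lemma embed_sum (I : Type) (s : seq I) (x : I -> 'rV[int]_d) :
  embed (\sum_(i <- s) x i) = \sum_(i <- s) embed (x i).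
Proof. by elim/big_ind2 : _ => [|x1 x2 y1 y2 <- <-|//]; rewrite ?embed0 ?embedD. Qed.

Lemma normr_entry (x : 'rV[R]_d) i j : `|x i j| <= `|x|.
Proof.
rewrite [leRHS]/Num.Def.normr /= mx_normrE; exact: (le_bigmax _ (fun ij => `|x ij.1 ij.2|) (i, j)).
Qed.

Lemma rV_delta_sum (x : 'rV[R]_d) : x = \sum_j x ord0 j *: delta_mx ord0 j.
Proof. by rewrite {1}[x]matrix_sum_delta big_ord1. Qed.

End embed.

(** * Lattice points reachable in a given number of steps *)

Section lattice_walk.
Context {d : nat}.
Variable J : {fset 'rV[int]_d}.

(** Starts at the origin at time 0, unlike [reach], and takes finite sets as values, so that sums
    over reachable points are finite; the two agree at positive times. *)
Fixpoint nstep n : {fset 'rV[int]_d} :=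
  if n is m.+1 then [fset (x + e)%R | x in nstep m, e in J]%fset else [fset 0%R]%fset.

Arguments nstep : simpl never.

Lemma nstep0 x : (x \in nstep 0) = (x == 0). Proof. by rewrite inE. Qed.

Lemma nstepS n y :
  y \in nstep n.+1 <-> exists x e, [/\ x \in nstep n, e \in J & y = x + e].
Proof.
split=> [/imfset2P[x /= xn [e /= eJ ->]]|[x [e [xn eJ ->]]]]; first by exists x, e.
by apply/imfset2P; exists x => //; exists e.
Qed.

Lemma nstep1 e : (e \in nstep 1) = (e \in J).
Proof.
apply/idP/idP => [/nstepS[x [e' []]]|eJ].
  by rewrite inE => /eqP -> e'J ->; rewrite add0r.
by apply/nstepS; exists 0, e; rewrite nstep0 eqxx add0r.
Qed.

Lemma reach_nstep n : reach J n.+1 = [set` nstep n.+1].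
Proof.
elim: n => [|n IH].
  by apply/seteqP; split => e /=; rewrite nstep1.
rewrite [LHS]/= -/(reach J n.+1) IH; apply/seteqP; split => y /=.
  by move=> ?; apply/nstepS.
by move=> /nstepS.
Qed.

Lemma nstepD m n x y : x \in nstep m -> y \in nstep n -> x + y \in nstep (m + n).
Proof.
move=> xm; elim: n y => [y|n IH y].
  by rewrite nstep0 => /eqP ->; rewrite addr0 addn0.
move=> /nstepS[z [e [zn eJ ->]]]; rewrite addnS addrA.
by apply/nstepS; exists (x + z), e; split => //; exact: IH.
Qed.

Lemma nstepMn m x n : x \in nstep m -> x *+ n \in nstep (n * m).
Proof.
move=> xm; elim: n => [|n IH]; first by rewrite mulr0n nstep0.
by rewrite mulrS mulSn; exact: nstepD.
Qed.

Lemma nstep_sum (s : seq 'rV[int]_d) (c : 'rV[int]_d -> nat) :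
  {subset s <= J} -> \sum_(e <- s) e *+ c e \in nstep (\sum_(e <- s) c e).
Proof.
elim: s => [_|e s IH sJ]; first by rewrite !big_nil nstep0.
rewrite !big_cons; apply: nstepD; last by apply: IH => j js; apply: sJ; rewrite inE js orbT.
rewrite -[X in nstep X]muln1; apply: nstepMn.
by rewrite nstep1 sJ// inE eqxx.
Qed.

Lemma nstep_shull (R : realType) n x : x \in nstep n ->
  scaled_hull J (@embed R d) n%:R (embed x).
Proof.
elim: n x => [x|n IH x]; first by rewrite nstep0 => /eqP ->; rewrite embed0; exact: shull0.
move=> /nstepS[y [e [yn eJ ->]]]; rewrite embedD -natr1.
by apply: shullD; [exact: IH|apply: shull_gen].
Qed.

Hypothesis Jsym : forall e, e \in J -> - e \in J.

Lemma nstepN n x : x \in nstep n -> - x \in nstep n.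
Proof.
elim: n x => [x|n IH x]; first by rewrite !nstep0 => /eqP ->; rewrite oppr0.
move=> /nstepS[y [e [yn eJ ->]]]; rewrite opprD; apply/nstepS.
by exists (- y), (- e); split => //; [exact: IH|exact: Jsym].
Qed.

Variable e0 : 'rV[int]_d.
Hypothesis e0J : e0 \in J.

(** The detour [e0], [- e0] wastes two steps at a time, which is why parity enters. *)
Lemma nstep_pad m n x : x \in nstep m -> (m <= n)%N -> odd m = odd n -> x \in nstep n.
Proof.
move=> xm mn omn; have [k ->] : exists k, (n = m + k.*2)%N.
  by exists (n - m)./2; rewrite halfK oddB// omn addbb subn0 subnKC.
elim: k {mn omn} => [|k IH]; first by rewrite addn0.
rewrite doubleS !addnS; apply/nstepS; exists (x + e0), (- e0); split.
- by apply/nstepS; exists x, e0.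
- exact: Jsym.
- by rewrite addrK.
Qed.

Context {R : realType}.
Local Notation hull := (scaled_hull J (@embed R d)).

(* A vector that can be reached at all, with the right parity, is reached in the
   time dictated by the gauge of the hull up to a bounded delay: round down the
   coefficients of a real decomposition; the remainder ranges over a finite set. *)
Lemma nstep_control : exists K : nat, forall v m r,
  (exists m', v \in nstep m' /\ odd m' = odd m) ->
  hull r (embed v) -> r + K%:R <= m%:R -> v \in nstep m.
Proof.
(* After rounding, the remainder is a combination of jumps with coefficients in [[0, 1)], so its
   entries are bounded by [M]; shifting by [M] encodes it in a finite type. *)
pose M := Num.truncn (\sum_(e <- J) `|embed e : 'rV[R]_d|).
pose dec (p : 'rV['I_(M.*2.+1)]_d) : 'rV[int]_d := \row_j ((p ord0 j)%:Z - M%:Z).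
pose A (i : 'rV['I_(M.*2.+1)]_d * bool) m := dec i.1 \in nstep m /\ odd m = i.2.
have [K HK] := uniform_witness_bound A.
exists K => v m r [m' [vm' om]] [a [a0 ar va]] rKm.
pose c e := Num.truncn (a e).
have ca e : (c e)%:R <= a e by have /andP[] := truncn_itv (a0 e).
have ac e : a e - (c e)%:R < 1.
  by have /andP[_] := truncn_itv (a0 e); rewrite -natr1 -/(c e); lra.
pose v0 := \sum_(e <- J) e *+ c e; pose n0 := (\sum_(e <- J) c e)%N.
have v0n : v0 \in nstep n0 by exact: nstep_sum.
have n0r : n0%:R <= r.
  by apply: le_trans ar; rewrite natr_sum; apply: ler_sum.
have v'norm : `|embed (v - v0) : 'rV[R]_d| <= \sum_(e <- J) `|embed e : 'rV[R]_d|.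
  rewrite embedB va embed_sum -sumrB; apply: le_trans (ler_norm_sum _ _ _) _.
  apply: ler_sum => e _; rewrite embedMn -scalerBl normrZ ger0_norm ?subr_ge0//.
  by rewrite ler_piMl// ltW.
have v'M j : (`|(v - v0) ord0 j| <= M%:Z).
  have := le_trans (normr_entry (embed (v - v0) : 'rV[R]_d) ord0 j) v'norm.
  rewrite mxE -intr_norm => h; rewrite -ltzD1 -(ltr_int R).
  apply: le_lt_trans h _.
  have /truncn_itv/andP[_] : 0 <= \sum_(e <- J) `|embed e : 'rV[R]_d| by exact: sumr_ge0.
  by rewrite -/M intrD -natr1.
pose p : 'rV['I_(M.*2.+1)]_d := \row_j inord (absz ((v - v0) ord0 j + M%:Z)).
have pE : dec p = v - v0.
  apply/rowP => j; rewrite [LHS]mxE [p _ _]mxE inordK; have := v'M j;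
    rewrite -?[0]/ord0; move: ((v - v0) ord0 j) => z; lia.
(* The remainder [v - v0] is reachable in [m' + n0] steps because [- v0] is reachable in [n0] steps
   by symmetry; this witness is traded for one bounded by [K] with the same parity. *)
have [|m1 m1K [m1v om1]] := HK (p, odd (m' + n0)).
  exists (m' + n0)%N; split => //=; rewrite pE; apply: nstepD => //; exact: nstepN.
rewrite /= pE in m1v om1.
apply: (@nstep_pad (m1 + n0)).
- by rewrite -(subrK v0 v); exact: nstepD.
- rewrite -(ler_nat R) natrD; have : (m1%:R : R) <= K%:R by rewrite ler_nat.
  lra.
- by rewrite oddD om1 -om oddD -addbA addbb addbF.
Qed.

Lemma shull_exact r x : hull r x -> exists a : 'rV[int]_d -> R,
  [/\ forall e, 0 <= a e, \sum_(e <- J) a e = r & x = \sum_(e <- J) a e *: embed e].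
Proof.
move=> [a [a0 ar ->]]; pose h := (r - \sum_(e <- J) a e) / 2.
have h0 : 0 <= h by rewrite divr_ge0// subr_ge0.
have pick (V : lmodType R) (f : 'rV[int]_d -> V) e : e \in J ->
    \sum_(e' <- J) (h * (e' == e)%:R) *: f e' = h *: f e.
  move=> eJ; rewrite (bigD1_seq e)//= eqxx mulr1 big1 ?addr0// => e' /negbTE ->.
  by rewrite mulr0 scale0r.
have pick1 e : e \in J -> \sum_(e' <- J) (h * (e' == e)%:R) = h.
  move=> eJ; rewrite (bigD1_seq e)//= eqxx mulr1 big1 ?addr0// => e' /negbTE ->.
  by rewrite mulr0.
exists (fun e => a e + (h * (e == e0)%:R + h * (e == - e0)%:R)); split.
- by move=> e; rewrite !addr_ge0// mulr_ge0.
- by rewrite !big_split/= !pick1 ?Jsym// /h; lra.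
- under [RHS]eq_bigr do rewrite !scalerDl.
  by rewrite !big_split/= !pick ?Jsym// embedN scalerN subrr addr0.
Qed.

Lemma convex_hullE : convex_hull (@embed R d @` [set` J]) = hull 1.
Proof.
apply/seteqP; split => x.
  apply; split.
    move=> y z t; rewrite !inE => hy hz.
    rewrite -[1](_ : t%:num * 1 + (1 - t%:num) * 1 = 1); last by rewrite !mulr1 subrKC.
    by apply: shullD; apply: shullZ => //; rewrite subr_ge0.
  by move=> _ [e /= eJ <-]; exact: shull_gen.
move=> hx A [cA JA]; apply: shull_sub_convex hx => //; last first.
  by move=> e eJ; apply: JA; exists e.
(* The origin is the midpoint of [e0] and [- e0], so it lies in every convex set containing the
   jumps. *)
have h01 : Itv.spec (@Itv.num_sem R) (Itv.Real `[0%Z, 1%Z]) 2^-1.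
  by rewrite /= /Itv.num_sem /= in_itv /= num_real/=; lra.
have mA e : e \in J -> embed e \in A by move=> eJ; rewrite inE; apply: JA; exists e.
have := cA (embed e0) (embed (- e0)) (Itv.mk h01) (mA _ e0J) (mA _ (Jsym e0J)).
rewrite inE; congr A; rewrite embedN /conv /= /unstable.onem.
by rewrite scalerN -scalerBl (_ : _ - _ = 0) ?scale0r//; lra.
Qed.

(** Rounding down the coefficients of [n%:R *: x] loses less than one step per jump; the at most
    [size J] missing steps are filled with [e0]. The two summands of the constant account for these
    two errors. *)
Lemma nstep_target : exists K : R, forall x n, hull 1 x ->
  exists2 t, t \in nstep n & `|embed t - n%:R *: x| <= K.
Proof.
pose S := \sum_(e <- J) `|embed e : 'rV[R]_d|.
exists (S + (size J)%:R * `|embed e0 : 'rV[R]_d|) => x n /shull_exact[a [a0 a1 ->]].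
pose c e := Num.truncn (n%:R * a e).
have na e : 0 <= n%:R * a e by rewrite mulr_ge0.
have ca e : (c e)%:R <= n%:R * a e by have /andP[] := truncn_itv (na e).
have ac e : n%:R * a e <= (c e)%:R + 1.
  by have /andP[_] := truncn_itv (na e); rewrite -natr1 -/(c e); lra.
pose m := (\sum_(e <- J) c e)%N.
have nE : n%:R = \sum_(e <- J) n%:R * a e by rewrite -mulr_sumr a1 mulr1.
have mn : (m <= n)%N by rewrite -(ler_nat R) natr_sum nE; apply: ler_sum.
have nm : (n - m)%:R <= (size J)%:R :> R.
  rewrite natrB// lerBlDr nE -[X in X%:R + _]sum1_size 2!natr_sum -big_split/=.
  by apply: ler_sum => e _; rewrite addrC.
exists (\sum_(e <- J) e *+ c e + e0 *+ (n - m)).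
  rewrite -(subnKC mn) addKn; apply: nstepD; first exact: nstep_sum.
  by rewrite -[X in nstep X]muln1; apply: nstepMn; rewrite nstep1.
rewrite embedD embedMn embed_sum addrAC scaler_sumr -sumrB.
apply: le_trans (ler_normD _ _) _; rewrite lerD//; last first.
  by rewrite normrZ ger0_norm// ler_wpM2r.
apply: le_trans (ler_norm_sum _ _ _) _; apply: ler_sum => e _.
rewrite embedMn scalerA -scalerBl normrZ ler_piMl// ler_norml; apply/andP; split.
  by have := ac e; lra.
by have := ca e; lra.
Qed.

Lemma shull_closed : closed (hull 1).
Proof.
apply: compact_closed; first exact: norm_hausdorff.
by apply: shull_compact; exact: fset_uniq.
Qed.

Lemma limit_shapeE : limit_shape J = hull 1.
Proof.
apply/seteqP; split => x.
  move=> [x_ [xr xcv]].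
  apply: (@closed_cvg _ _ _ _ x_ (hull 1) shull_closed _ x xcv).
  exists 1%N => // -[//|n] _; have [y + <-] := xr n.+1 isT.
  rewrite reach_nstep => yn; have := shullZ _ (nstep_shull R yn).
  by move=> /(_ n.+1%:R^-1); rewrite mulVf ?pnatr_eq0//; apply; rewrite invr_ge0.
move=> hx; have [K HK] := nstep_target.
have /choice[t tP] n : exists t, t \in nstep n /\ `|embed t - n%:R *: x| <= K.
  by have [t tn tK] := HK x n hx; exists t.
have K0 : 0 <= K by apply: le_trans (proj2 (tP 0%N)).
exists (fun n => n%:R^-1 *: embed (t n)); split.
  by move=> [//|n] _; exists (t n.+1) => //; rewrite reach_nstep; exact: (tP _).1.
apply/cvgrPdist_lt => e egt0.
exists (Num.truncn (K / e)).+1 => // -[//|n] /= nK.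
rewrite distrC -[x in _ - x](@scalerK _ _ n.+1%:R) ?pnatr_eq0// -scalerBr normrZ.
rewrite ger0_norm ?invr_ge0// mulrC ltr_pdivrMr//.
apply: le_lt_trans (tP _).2 _; rewrite mulrC -ltr_pdivrMr//.
have /truncn_itv/andP[_] : 0 <= K / e by rewrite divr_ge0// ltW.
by move=> /lt_le_trans; apply; rewrite ler_nat.
Qed.

Lemma gauge_of_nbhs : nbhs (0 : 'rV[R]_d) (hull 1) ->
  exists2 C : R, 0 < C & forall x, hull (C * `|x|) x.
Proof.
(* The factor 2 rescales [x] to length [e / 2], strictly inside the ball. *)
move=> /nbhs_ballP[e /= egt0 be]; exists (2 / e); first by rewrite divr_gt0.
move=> x; have [->|x0] := eqVneq x 0; first by apply: shull0; rewrite normr0 mulr0.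
have nx : 0 < `|x| by rewrite normr_gt0.
have t0 : 0 < 2 / e * `|x| by rewrite mulr_gt0// divr_gt0.
rewrite -[X in hull X _]mulr1 -[x in hull _ x](@scalerKV _ _ (2 / e * `|x|)) ?gt_eqF//.
apply: shullZ; first exact: ltW.
apply: be; rewrite -ball_normE /= sub0r normrN normrZ gtr0_norm ?invr_gt0//.
have -> : (2 / e * `|x|)^-1 * `|x| = e / 2 by field; rewrite !gt_eqF.
by rewrite ltr_pdivrMr// ltr_pMr// ltr1n.
Qed.

End lattice_walk.

(** Here the gauge of the hull is the l1 norm, which is at most [d] times the sup norm. *)
Lemma gauge_nearest_neighbor (R : realType) (d : nat) (J : {fset 'rV[int]_d}) :
  (0 < d)%N -> nearest_neighbor J ->
  exists2 C : R, 0 < C & forall x, scaled_hull J (@embed R d) (C * `|x|) x.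
Proof.
move=> d0 nn; exists d%:R; first by rewrite ltr0n.
have deltaJ (b : bool) j : (if b then 1 else -1) *: delta_mx ord0 j \in J.
  rewrite nn; apply/eqP; rewrite (bigD1 j)//= !mxE !eqxx/= big1.
    by rewrite addr0 mulr1; case: b.
  by move=> i /negbTE ij; rewrite !mxE ij andbF mulr0 normr0.
move=> x; rewrite {2}(rV_delta_sum x).
apply: (@shull_le _ _ _ _ _ (\sum_(j < d) `|x ord0 j|)).
  rewrite mulr_natl -[X in _ *+ X]card_ord -sumr_const.
  by apply: ler_sum => j _; exact: normr_entry.
apply: shull_sum => j; rewrite -[X in scaled_hull _ _ X]mulr1.
have /(shull_gen (embed (R := R)) (fset_uniq J))/(shullZ (normr_ge0 (x ord0 j))) :=
  deltaJ (0 <= x ord0 j) j.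
congr (scaled_hull _ _ _ _); apply/rowP => i; rewrite !mxE.
rewrite rmorphM/= rmorph_nat; case: (leP 0 (x ord0 j)) => [xj|xj].
  by rewrite ger0_norm// mul1r.
by rewrite ltr0_norm// rmorphN mulN1r mulrNN.
Qed.

(** * Superadditive processes *)

Lemma exists_invn_lt (R : realType) (e : R) : 0 < e -> exists i : nat, i.+1%:R^-1 < e.
Proof.
move=> e0; have /cvgrPdist_lt := @cvg_harmonic R => /(_ _ e0)[i _ /(_ i (leqnn i))].
by rewrite sub0r normrN ger0_norm ?invr_ge0// => ?; exists i.
Qed.

Lemma eventually_le_mulrn (R : realType) (x e : R) : 0 < e ->
  exists N, forall n, (N <= n)%N -> x <= e * n%:R.
Proof.
move=> e0; exists (Num.truncn (`|x| / e)).+1 => n Nn.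
rewrite mulrC -ler_pdivrMr//; apply: (@le_trans _ _ (`|x| / e)).
  by rewrite ler_pM2r ?invr_gt0// ler_norm.
have /truncn_itv/andP[_ /ltW/le_trans] : 0 <= `|x| / e by rewrite divr_ge0// ltW.
by apply; rewrite ler_nat.
Qed.

(* Read [0, n) from left to right: outside B jump over a block of length at most N on
   which g gains at least c per unit of time, inside B take a single step. *)
Lemma greedy_lower_bound (R : realType) (X : Type) (T : X -> X) (g : nat -> X -> R)
    (K c : R) (N : nat) (B : set X) :
  0 <= K -> - K <= c ->
  (forall n w, - (K * n%:R) <= g n w) ->
  (forall m n w, g m w + g n (iter m T w) <= g (m + n)%N w) ->
  (forall w, ~ B w -> exists m, [/\ (0 < m)%N, (m <= N)%N & c * m%:R <= g m w]) ->
  forall n w,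
    c * n%:R - (c + K) * (\sum_(i < n) \1_B (iter i T w) + N%:R) <= g n w.
Proof.
move=> K0 Kc g_ge g_super g_good n.
have h0 m w : 0 <= \sum_(i < m) (\1_B (iter i T w) : R).
  by apply: sumr_ge0 => i _; rewrite indicE.
have cK : 0 <= c + K by lra.
elim/ltn_ind: n => -[|n] IH w.
  have := g_ge 0%N w; rewrite !mulr0 big_ord0; apply: le_trans.
  by rewrite sub0r add0r oppr0 oppr_le0 mulr_ge0.
have [Bw|nBw] := pselect (B w).
  have := IH n (ltnSn n) (T w).
  have := g_super 1%N n w; have := g_ge 1%N w.
  rewrite /= add1n big_ord_recl /= indicE mem_set// mulr1.
  under [in X in _ -> _ -> _ -> X]eq_bigr do rewrite -iterS iterSr.
  set s := \sum_(i < n) _ => a b e; rewrite -natr1.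
  rewrite (_ : true%:R = 1)//; lra.
have [m [m0 mN gm]] := g_good w nBw.
(* A block that overshoots the horizon is discarded: fewer than [N] steps remain, and the term
   [N%:R] pays [c + K] for each. *)
have [mn|nm] := leqP m n.+1; last first.
  apply: le_trans (g_ge _ _).
  have : (c + K) * n.+1%:R <= (c + K) * N%:R.
    by apply: ler_wpM2l => //; rewrite ler_nat; lia.
  have := mulr_ge0 cK (h0 n.+1 w); lra.
have -> : n.+1 = (m + (n.+1 - m))%N by lia.
apply: le_trans (g_super _ _ _); apply: le_trans (lerD gm (IH _ _ _)); last by lia.
rewrite big_split_ord /= natrD.
under [\sum_(i < n.+1 - m) _]eq_bigr do rewrite addnC iterD.
have := mulr_ge0 cK (h0 m w); lra.
Qed.

(** * Maximal inequality and almost sure growth of superadditive sequences *)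

Section ergodic.
Context {d : measure_display} {X : measurableType d} {R : realType}.
Variable P : probability X R.

(** The intersection of the covers is a measurable null set, so [Z] itself requires no measurability
    proof. *)
Lemma negligible_small (Z : set X) :
  (forall e : R, 0 < e -> exists A, [/\ measurable A, Z `<=` A & (P A <= e%:E)%E]) ->
  P.-negligible Z.
Proof.
move=> small.
have /choice[A Aprop] (k : nat) : exists A,
    [/\ measurable A, Z `<=` A & (P A <= (k.+1%:R^-1)%:E)%E].
  exact: small.
have mA k : measurable (A k) by case: (Aprop k).
exists (\bigcap_k A k); split; first exact: bigcapT_measurable.
  apply/eqP; rewrite eq_le measure_ge0 andbT; apply/lee_addgt0Pr => e e0.
  rewrite add0e; have [k ke] := exists_invn_lt e0.
  apply: (@le_trans _ _ (P (A k))).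
    by apply: le_measure; rewrite ?inE//; [exact: bigcapT_measurable|exact: bigcap_inf].
  by case: (Aprop k) => _ _ /le_trans; apply; rewrite lee_fin ltW.
by move=> w Zw k _; case: (Aprop k) => _ + _; exact.
Qed.

Lemma aeS (A B : X -> Prop) : (forall w, A w -> B w) ->
  {ae P, forall w, A w} -> {ae P, forall w, B w}.
Proof. by move=> AB hA; apply: negligibleS hA => w /= nB Aw; exact/nB/AB. Qed.

Lemma aeS2 (A B C : X -> Prop) : (forall w, A w -> B w -> C w) ->
  {ae P, forall w, A w} -> {ae P, forall w, B w} -> {ae P, forall w, C w}.
Proof.
move=> ABC hA hB; apply: negligibleS (negligibleU hA hB) => w /= nC.
by apply: contra_notP nC => /not_orP[/contrapT Aw /contrapT Bw]; exact: ABC.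
Qed.

Lemma negligible_setC (A : set X) :
  measurable A -> P A = 1%E -> P.-negligible (~` A).
Proof.
move=> mA PA; have PC : P (~` A) = 0%E by rewrite probability_setC// PA subee.
by apply/negligibleP; [exact: measurableC|exact: PC].
Qed.

(** The tail unions decrease to a null set, so almost sure convergence gives convergence in
    probability. *)
Lemma eventually_probability_small (B : nat -> set X) :
  (forall n, measurable (B n)) ->
  {ae P, forall w, exists N, forall n, (N <= n)%N -> ~ B n w} ->
  forall e : R, 0 < e -> exists N, forall n, (N <= n)%N -> (P (B n) < e%:E)%E.
Proof.
move=> mB aeB e e0; pose F N := \bigcup_(n in [set n | (N <= n)%N]) B n.
have mF N : measurable (F N) by exact: bigcup_measurable.
have mFF : measurable (\bigcap_N F N) by exact: bigcapT_measurable.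
have F0 : P (\bigcap_N F N) = 0%E.
  apply/negligibleP => //; apply: negligibleS aeB => w Fw /= [N hN].
  by have [n Nn Bn] := Fw N I; exact: hN Bn.
have : P \o F @ \oo --> P (\bigcap_N F N).
  apply: nonincreasing_cvg_mu => //.
    by rewrite (le_lt_trans (probability_le1 _ _)) ?ltry.
  move=> n m nm; apply/subsetPset => w [k /= mk Bk].
  by exists k => //=; exact: leq_trans mk.
rewrite F0 => /fine_cvgP[_ /cvgrPdist_lt/(_ _ e0)[N _ hN]].
exists N => n Nn; have /= := hN n Nn; rewrite sub0r normrN => Fe.
apply: (@le_lt_trans _ _ (P (F n))).
  by apply: le_measure; rewrite ?inE// => w Bw; exists n => /=.
rewrite -[P (F n)]fineK ?fin_num_measure// lte_fin.
exact: le_lt_trans (ler_norm _) Fe.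
Qed.

Lemma le_sum_probability (I : finType) (a : I -> R) (E : I -> set X) (c : R) :
  0 <= c -> (forall i, 0 <= a i) -> (forall i, measurable (E i)) ->
  (forall w, c <= \sum_i a i * \1_(E i) w) ->
  c <= \sum_i a i * fine (P (E i)).
Proof.
move=> c0 a0 mE ub; rewrite -lee_fin -sumEFin.
under eq_bigr do rewrite EFinM fineK ?fin_num_measure//.
have -> : c%:E = (\int[P]_w (cst c%:E) w)%E.
  by rewrite integral_cst// [X in (_ * X)%E]probability_setT mule1.
have mI i : measurable_fun [set: X] (\1_(E i) : X -> R) by exact: measurable_indic.
have mE1 i : measurable_fun [set: X] (EFin \o (\1_(E i) : X -> R)).
  exact/measurable_EFinP.
have I0 i w : (0 <= (a i)%:E * (\1_(E i) w)%:E)%E.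
  by rewrite -EFinM lee_fin mulr_ge0.
have maE i : measurable_fun [set: X] (fun w => ((a i)%:E * (\1_(E i) w)%:E)%E : \bar R).
  exact: emeasurable_funM (measurable_cst _) (mE1 i).
have : (\int[P]_w (cst c%:E) w <=
    \int[P]_w (\sum_i (a i)%:E * (\1_(E i) w)%:E))%E.
  apply: ge0_le_integral => //.
  - exact: emeasurable_sum.
  - move=> w _; under eq_bigr do rewrite -EFinM.
    by rewrite sumEFin lee_fin.
move=> /le_trans; apply; rewrite ge0_integral_sum//; apply: lee_sum => i _.
rewrite ge0_integralZl_EFin//; first by rewrite integral_indic ?setIT.
exact: mE1.
Qed.

Variable T : X -> X.
Hypothesis mT : forall A, measurable A -> measurable (T @^-1` A).
Hypothesis PT : forall A, measurable A -> P (T @^-1` A) = P A.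

Lemma measurable_iter_preimage n A :
  measurable A -> measurable ((iter n T) @^-1` A).
Proof.
move=> mA; elim: n => // n IH.
by rewrite (_ : _ @^-1` A = T @^-1` (iter n T @^-1` A)); [exact: mT|];
  apply/funext => w /=; rewrite -iterS iterSr.
Qed.

Lemma probability_iter_preimage n A :
  measurable A -> P ((iter n T) @^-1` A) = P A.
Proof.
move=> mA; elim: n => // n <-.
rewrite -[RHS]PT; last exact: measurable_iter_preimage.
by congr (P _); apply/funext => w /=; rewrite -iterS iterSr.
Qed.

Let visits (B : set X) n w : R := \sum_(i < n) \1_B (iter i T w).

Let visitsD B m n w : visits B m w + visits B n (iter m T w) = visits B (m + n) w.
Proof.
rewrite /visits big_split_ord; congr (_ + _); apply: eq_bigr => i _ /=.
by rewrite -iterD addnC.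
Qed.

Let measurable_visits B n c : measurable B ->
  measurable [set w | c <= visits B n w].
Proof.
move=> mB; rewrite -[X in measurable X]setTI.
have : measurable_fun setT (visits B n).
  apply: measurable_sum => i; rewrite (_ : (fun _ => _) = \1_(iter i T @^-1` B)) //.
  by apply: measurable_indic; exact: measurable_iter_preimage.
move=> /(_ measurableT `[c, +oo[%classic (measurable_itv _)).
congr (measurable (_ `&` _)).
by apply/seteqP; split => w /=; rewrite in_itv /= andbT.
Qed.

(* The greedy bound applied to the visit counts, the exceptional set being the good set. *)
Lemma maximal_inequality_trunc (B : set X) (c : R) M : measurable B -> 0 < c ->
  c * fine (P [set w | exists m, [/\ (0 < m)%N, (m <= M)%N & c * m%:R <= visits B m w]])
  <= fine (P B).
Proof.
move=> mB c0; set A := [set w | _].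
have mA : measurable A.
  rewrite (_ : A = \bigcup_(m in [set m | (0 < m <= M)%N]) [set w | c * m%:R <= visits B m w]).
    by apply: bigcup_measurable => m _; exact: measurable_visits.
  apply/seteqP; split => w [m].
    by case=> m0 mM cm; exists m => //=; rewrite m0.
  by move=> /andP[m0 mM] cm; exists m; split.
have key n : (M < n)%N -> c * fine (P A) <= fine (P B) + c * M%:R / n%:R.
  move=> Mn; have n0 : 0 < (n%:R : R) by rewrite ltr0n (leq_ltn_trans _ Mn).
  (* One family gathers the visits to [B], with weight 1, and those to the complement of [A], with
     weight [c]; by invariance each event in it has probability [P B] or [1 - P A]. *)
  pose E (i : 'I_n + 'I_n) := match i with
    | inl i => iter i T @^-1` B | inr i => iter i T @^-1` ~` A end.
  pose a (i : 'I_n + 'I_n) := if i is inl _ then 1 else c.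
  have := @le_sum_probability _ a E (c * n%:R - c * M%:R).
  rewrite !big_sumType /=.
  under [in X in _ -> _ -> _ -> _ -> _ <= X + _]eq_bigr do
    rewrite mul1r probability_iter_preimage//.
  under [in X in _ -> _ -> _ -> _ -> _ <= _ + X]eq_bigr do
    rewrite (probability_iter_preimage _ (measurableC mA)) probability_setC//.
  rewrite !sumr_const card_ord -[X in fine (1 - X)]fineK ?fin_num_measure//.
  rewrite -EFinB /= -(mulr_natl (fine (P B))) -(mulr_natl (c * _)) => H.
  have {}H : c * n%:R - c * M%:R <= n%:R * fine (P B) + n%:R * (c * (1 - fine (P A))).
    apply: H.
    - rewrite -mulrBr; apply: mulr_ge0; first exact: ltW.
      by rewrite subr_ge0 ler_nat ltnW.
    - by case=> i //=; exact: ltW.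
    - by case=> i /=; apply: measurable_iter_preimage => //; exact: measurableC.
    - move=> w; rewrite big_sumType /=; have := @greedy_lower_bound R X T (visits B) 0 c M (~` A)
        (lexx 0) _ _ _ _ n w.
      have -> : \sum_(i < n) a (inl i) * \1_(E (inl i)) w = visits B n w.
        by apply: eq_bigr => i _; rewrite /= mul1r.
      have -> : \sum_(i < n) a (inr i) * \1_(E (inr i)) w =
                c * \sum_(i < n) \1_(~` A) (iter i T w).
        by rewrite mulr_sumr.
      set s := \sum_(i < n) \1_(~` A) _.
      rewrite addr0 mulrDr => G.
      suff : c * n%:R - (c * s + c * M%:R) <= visits B n w by lra.
      apply: G.
      + by rewrite oppr0 ltW.
      + by move=> m v; rewrite mul0r oppr0; apply: sumr_ge0 => i _; rewrite indicE.
      + by move=> m k v; rewrite visitsD.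
      + by move=> v /contrapT.
  rewrite -(ler_pM2l n0) mulrDr [n%:R * (_ / _)]mulrC divfK ?gt_eqF//; lra.
apply/ler_addgt0Pr => e e0.
have [N HN] := eventually_le_mulrn (c * M%:R) e0.
apply: (le_trans (key (N + M).+1 _)); first by rewrite ltnS leq_addl.
rewrite lerD2l ler_pdivrMr//; apply: HN.
exact: leq_trans (leq_addr _ _) (leqnSn _).
Qed.

(** The truncation is removed by continuity from below. This weak-type bound plays the part of a
    pointwise ergodic theorem, and [T] may fail to be ergodic. *)
Lemma maximal_inequality (B : set X) (c : R) : measurable B -> 0 < c ->
  exists A, [/\ measurable A, (P A <= (fine (P B) / c)%:E)%E &
    forall w, ~ A w -> forall n, \sum_(i < n) \1_B (iter i T w) <= c * n%:R].
Proof.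
move=> mB c0; pose E m := [set w | c * m.+1%:R <= visits B m.+1 w].
pose A M := \bigcup_(m in [set m | (m < M)%N]) E m.
have mE m : measurable (E m) by exact: measurable_visits.
have mA M : measurable (A M) by exact: bigcup_measurable.
have mAA : measurable (\bigcup_M A M) by exact: bigcupT_measurable.
exists (\bigcup_M A M); split => //.
  have /(_ mA mAA) cv := @nondecreasing_cvg_mu _ _ _ P A.
  rewrite -(cvg_lim _ (cv _))//; last first.
    move=> n m nm; apply/subsetPset => w [k /= kn Ek].
    by exists k => //=; exact: leq_trans nm.
  apply: lime_le.
    apply/cvg_ex; exists (P (\bigcup_M A M)); apply: cv.
    move=> n m nm; apply/subsetPset => w [k /= kn Ek].
    by exists k => //=; exact: leq_trans nm.
  apply: nearW => M /=; rewrite -[P _]fineK ?fin_num_measure// lee_fin.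
  rewrite ler_pdivlMr// mulrC; have := maximal_inequality_trunc M mB c0.
  congr (c * fine (P _) <= _); apply/seteqP; split => w.
    by move=> [[|m] [//= _ mM cm]]; exists m.
  by move=> [m /= mM cm]; exists m.+1.
move=> w nA [|n]; first by rewrite big_ord0 mulr0.
rewrite leNgt; apply/negP => /ltW cn; apply: nA.
by exists n.+1 => //; exists n => //=.
Qed.

(** A point is bad when no block of length at most [N] gains [c] per unit of time. Bad points are
    rare for large [N], hence rarely visited off a small set, and the greedy bound then loses
    little. *)
Lemma superadditive_liminf (g : nat -> X -> R) (K c : R) :
  0 <= K -> - K <= c ->
  (forall n w, - (K * n%:R) <= g n w) ->
  (forall m n w, g m w + g n (iter m T w) <= g (m + n)%N w) ->
  (forall n a, measurable [set w | a <= g n w]) ->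
  {ae P, forall w, exists n, (0 < n)%N /\ c * n%:R <= g n w} ->
  forall e, 0 < e ->
  {ae P, forall w, exists N, forall n, (N <= n)%N -> (c - e) * n%:R <= g n w}.
Proof.
move=> K0 Kc g_ge g_super mg ae_good e e0.
pose E m := [set w | c * m.+1%:R <= g m.+1 w].
pose B M := ~` \bigcup_(m in [set m | (m < M)%N]) E m.
have mB M : measurable (B M).
  by apply: measurableC; apply: bigcup_measurable => m _; exact: mg.
have aeB : {ae P, forall w, exists N, forall n, (N <= n)%N -> ~ B n w}.
  apply: filterS ae_good => w [[|n] [//= _ cn]].
  by exists n.+1 => m nm; apply; exists n.
apply: negligible_small => e' e'0.
(* A visit frequency [l] costs at most [e / 2] per unit of time, the other half being left for the
   boundary term; the summand 1 keeps the denominator positive when [c = - K]. *)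
pose l := e / (2 * (c + K + 1)).
have cK1 : 0 < c + K + 1 by lra.
have l0 : 0 < l by rewrite divr_gt0// mulr_gt0.
have lE : l * (c + K + 1) = e / 2.
  by rewrite /l invfM mulrA -mulrA mulVf ?gt_eqF// mulr1.
(* The threshold is [e' * l] because the maximal inequality divides by [l]. *)
have [N PN] := eventually_probability_small mB aeB (mulr_gt0 e'0 l0).
have [A [mA PA hA]] := maximal_inequality (mB N) l0.
exists A; split => //.
- move=> w /=; apply: contra_notP => nA.
  have [N0 HN0] := eventually_le_mulrn ((c + K) * N%:R) (divr_gt0 e0 (ltr0n R 2)).
  exists N0 => n Nn.
  have G : c * n%:R - (c + K) * (\sum_(i < n) \1_(B N) (iter i T w) + N%:R) <= g n w.
    apply: (@greedy_lower_bound _ _ _ g K c) => // v.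
    by move=> /contrapT[m mN Em]; exists m.+1.
  apply: le_trans G.
  have h1 := hA _ nA n; have h2 := HN0 n Nn.
  have h3 : (c + K) * \sum_(i < n) \1_(B N) (iter i T w) <= e / 2 * n%:R.
    apply: le_trans (ler_wpM2l _ h1) _; first by lra.
    rewrite mulrA ler_wpM2r// -lE mulrC ler_wpM2l//; lra.
  have : 0 <= n%:R :> R by [].
  rewrite mulrDr mulrBl; lra.
- apply: le_trans PA _; rewrite lee_fin ler_pdivrMr//.
  have := PN N (leqnn N); rewrite -[P _]fineK ?fin_num_measure// lte_fin.
  exact: ltW.
Qed.

End ergodic.

(** * The quenched walk in the environment *)

Lemma continuous_product (X : topologicalType) (I : Type)
    (T : I -> topologicalType) (g : X -> prod_topology T) :
  (forall i, continuous (fun x => g x i)) -> continuous g.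
Proof.
move=> cg x; apply/cvg_sup => i U.
have /= -> := @nbhsE (initial_topology (fun f : (forall i, T i) => f i)) (g x).
case=> B [[C oC <-] /= Cgx] /filterS; apply.
by apply: (cg i x C); exact: open_nbhs_nbhs.
Qed.

Lemma eval_continuous (I : eqType) (T : topologicalType) (i : I) :
  continuous (fun f : {ptws I -> T} => f i).
Proof. exact: (@proj_continuous I (fun=> T) i). Qed.

Lemma continuous_sum (R : realType) (X : topologicalType) (I : Type) (s : seq I)
    (f : I -> X -> R) : (forall i, continuous (f i)) ->
  continuous (fun x => \sum_(i <- s) f i x).
Proof.
move=> cf; apply: (@continuous_big R I +%R 0 xpredT) => //.
by move=> p; apply: (@cvgD _ R); [exact: cvg_fst|exact: cvg_snd].
Qed.

Section environment_walk.
Context {R : realType} {d : nat} (J : {fset 'rV[int]_d}) (kappa : R).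
Variable ne : elliptic_simplex J kappa !=set0.
Implicit Types (w : env_path ne) (x y : 'rV[int]_d).

Definition env_shift_by (n : nat) x w : env_path ne :=
  fun i y => w (n + i)%N (y + x).

Lemma env_shift_by0 w : env_shift_by 0 0 w = w.
Proof. by apply/funext => i; apply/funext => y; rewrite /env_shift_by addr0. Qed.

Lemma env_shift_byD m n x y w :
  env_shift_by n y (env_shift_by m x w) = env_shift_by (m + n) (x + y) w.
Proof.
apply/funext => i; apply/funext => z; rewrite /env_shift_by addnA.
by rewrite -addrA (addrC y).
Qed.

Lemma iter_env_shift_by j n x w :
  iter j (env_shift_by n x) w = env_shift_by (j * n) (x *+ j) w.
Proof.
elim: j => [|j IH]; first by rewrite mulr0n env_shift_by0.
by rewrite iterS IH env_shift_byD mulSn mulrS addnC addrC.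
Qed.

Lemma env_eval_continuous n y : continuous (fun w => w n y : site_law ne).
Proof.
move=> w; apply: (@continuous_comp (env_path ne) (env ne) (site_law ne)
  (fun w => w n) (fun eta => eta y)).
  exact: (@eval_continuous _ (env ne) n).
exact: (@eval_continuous _ (site_law ne) y).
Qed.

Lemma env_shift_by_continuous n x : continuous (env_shift_by n x).
Proof.
apply: continuous_product => i; apply: continuous_product => y.
exact: env_eval_continuous.
Qed.

Lemma jump_prob_continuous n y e : continuous (fun w => jump_prob w n y e : R).
Proof.
move=> w; apply: (@continuous_comp _ (site_law ne) R
  (fun w => w n y) (fun v : site_law ne => set_val v e)).
  exact: env_eval_continuous.
apply: (@continuous_comp (site_law ne) {ptws J -> R} R set_val (fun v => v e)).
  exact: initial_continuous.
exact: eval_continuous.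
Qed.

Lemma jump_prob_simplex w n y : elliptic_simplex J kappa (set_val (w n y)).
Proof. by case: (w n y) => v i; exact: set_mem i. Qed.

Lemma jump_prob_ge w n y e : kappa <= jump_prob w n y e.
Proof. by have [h _] := jump_prob_simplex w n y; exact: h. Qed.

Lemma jump_prob_sum w n y : \sum_(e : J) jump_prob w n y e = 1.
Proof. by have [_ h] := jump_prob_simplex w n y. Qed.

(* walk_prob w n v is the quenched probability that the walk started at the
   origin sits at v at time n. *)
Fixpoint walk_prob w n v : R :=
  if n is m.+1
  then \sum_(e : J) walk_prob w m (v - val e) * jump_prob w m (v - val e) e
  else (v == 0)%:R.

Hypothesis kappa_gt0 : 0 < kappa.

Lemma jump_prob_ge0 w n y e : 0 <= jump_prob w n y e.
Proof. exact: le_trans (ltW kappa_gt0) (jump_prob_ge _ _ _ _). Qed.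

Lemma walk_prob_ge0 w n v : 0 <= walk_prob w n v.
Proof.
elim: n v => [|n IH] v /=; first exact: ler0n.
by apply: sumr_ge0 => e _; rewrite mulr_ge0// jump_prob_ge0.
Qed.

Lemma walk_prob_continuous n v : continuous (fun w => walk_prob w n v).
Proof.
elim: n v => [|n IH] v.
  have -> : (fun w => walk_prob w 0 v) = cst ((v == 0)%:R : R) by [].
  by move=> w; apply: cst_continuous.
apply: (@continuous_sum R _ _ _ (fun (e : J) w =>
  walk_prob w n (v - val e) * jump_prob w n (v - val e) e)) => e w.
apply: (@continuousM R (env_path ne) (fun w => walk_prob w n (v - val e))
  (fun w => jump_prob w n (v - val e) e) w); first exact: IH.
exact: jump_prob_continuous.
Qed.

(** Half of Chapman-Kolmogorov, the set [s] of intermediate sites being arbitrary. A singleton gives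
    supermultiplicativity; all sites of a ball together give the steering bound. *)
Lemma walk_prob_shift_le w m n v (s : seq 'rV[int]_d) : uniq s ->
  \sum_(y <- s) walk_prob w m y * walk_prob (env_shift_by m y w) n (v - y)
  <= walk_prob w (m + n) v.
Proof.
move=> us; elim: n v => [|n IH] v.
  rewrite addn0; have [vs|vs] := boolP (v \in s).
    rewrite (bigD1_seq v)//= subrr eqxx mulr1 big1 ?addr0// => y.
    by rewrite eq_sym -subr_eq0 => /negbTE ->; rewrite mulr0.
  rewrite big_seq big1 ?walk_prob_ge0// => y ys /=; rewrite subr_eq0.
  by case: eqVneq ys => [<-|]; rewrite ?(negbTE vs)// mulr0.
rewrite addnS /=; under eq_bigr do rewrite mulr_sumr.
rewrite exchange_big /=; apply: ler_sum => e _.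
rewrite [X in X <= _](_ : _ = (\sum_(y <- s) walk_prob w m y *
    walk_prob (env_shift_by m y w) n (v - val e - y)) *
    jump_prob w (m + n) (v - val e) e).
  by apply: ler_wpM2r; [exact: jump_prob_ge0|exact: IH].
rewrite mulr_suml; apply: eq_bigr => y _; rewrite mulrA (addrAC v).
by rewrite /jump_prob /env_shift_by subrK.
Qed.

Lemma walk_probM_le w m n x y :
  walk_prob w m x * walk_prob (env_shift_by m x w) n y <= walk_prob w (m + n) (x + y).
Proof.
have := @walk_prob_shift_le w m n (x + y) [:: x] isT.
by rewrite big_seq1 addrAC subrr add0r.
Qed.

Lemma walk_prob_ge w n v : v \in nstep J n -> kappa ^+ n <= walk_prob w n v.
Proof.
elim: n v => [v|n IH v]; first by rewrite nstep0 => /eqP ->; rewrite /= eqxx.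
move=> /nstepS[y [e [yn eJ ->]]] /=; rewrite (bigD1 (FSetSub eJ))//= addrK exprSr.
rewrite -[leLHS]addr0 lerD//; last first.
  by apply: sumr_ge0 => e' _; rewrite mulr_ge0 ?walk_prob_ge0 ?jump_prob_ge0.
by apply: ler_pM; rewrite ?exprn_ge0 ?(ltW kappa_gt0) ?IH ?jump_prob_ge.
Qed.

Lemma ler_sum_subseq (I : eqType) (s t : seq I) (h : I -> R) :
  uniq s -> {subset s <= t} -> (forall i, 0 <= h i) ->
  \sum_(i <- s) h i <= \sum_(i <- t) h i.
Proof.
elim: s t => [|i s IH] t /=; first by rewrite big_nil => *; exact: sumr_ge0.
move=> /andP[is_ us] st h0; have it : i \in t by apply: st; rewrite inE eqxx.
rewrite big_cons (big_rem i it)/= lerD2l; apply: IH => // j js.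
have : j \in t by apply: st; rewrite inE js orbT.
rewrite (perm_mem (perm_to_rem it)) inE => /orP[/eqP ji|//].
by move: is_; rewrite -ji js.
Qed.

Lemma walk_prob_sum_ge1 w n : 1 <= \sum_(v <- nstep J n) walk_prob w n v.
Proof.
elim: n => [|n IH].
  by rewrite big_seq_fset1 /= eqxx.
apply: (le_trans IH) => /=.
rewrite exchange_big/= [X in X <= _](_ : _ = \sum_(e : J) \sum_(u <- nstep J n)
    walk_prob w n u * jump_prob w n u e); last first.
  by rewrite exchange_big/=; apply: eq_bigr => u _; rewrite -mulr_sumr jump_prob_sum mulr1.
apply: ler_sum => e _.
rewrite [X in X <= _](_ : _ = \sum_(v <- [seq u + val e | u <- nstep J n])
    walk_prob w n (v - val e) * jump_prob w n (v - val e) e); last first.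
  by rewrite big_map; apply: eq_bigr => u _; rewrite addrK.
apply: ler_sum_subseq.
- by rewrite map_inj_uniq ?fset_uniq//; exact: addIr.
- by move=> v /mapP[u un ->]; apply/nstepS; exists u, (val e); split => //; exact: valP.
- by move=> v; rewrite mulr_ge0 ?walk_prob_ge0 ?jump_prob_ge0.
Qed.

End environment_walk.

(** * Zero-one law for the space-time shifts *)

Section ergodic_rate.
Context {R : realType} {d : nat} (J : {fset 'rV[int]_d}) (kappa : R).
Variable ne : elliptic_simplex J kappa !=set0.
Hypothesis kappa_gt0 : 0 < kappa.
Variable P : probability (borelType (env_path ne)) R.
Local Notation OmegaN := (borelType (env_path ne)).

Lemma walk_prob_sum_le1 (w : env_path ne) n (s : seq 'rV[int]_d) : uniq s ->
  \sum_(v <- s) walk_prob w n v <= 1.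
Proof.
elim: n s => [|n IH] s us /=.
  have [s0|s0] := boolP (0 \in s).
    by rewrite (bigD1_seq 0)//= eqxx big1 ?addr0// => v /negbTE ->.
  rewrite big_seq big1 ?ler01// => v vs.
  by case: eqVneq vs => [->|]; rewrite ?(negbTE s0).
rewrite exchange_big/=.
pose t := undup [seq v - e | v <- s, e <- enum_fset J].
apply: le_trans (IH t (undup_uniq _)).
rewrite [X in _ <= X](_ : _ = \sum_(e : J) \sum_(u <- t)
    walk_prob w n u * jump_prob w n u e); last first.
  by rewrite exchange_big/=; apply: eq_bigr => u _; rewrite -mulr_sumr jump_prob_sum mulr1.
apply: ler_sum => e _.
rewrite [X in X <= _](_ : _ = \sum_(u <- [seq v - val e | v <- s])
    walk_prob w n u * jump_prob w n u e); last by rewrite big_map.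
apply: ler_sum_subseq.
- by rewrite map_inj_uniq// => x y /addIr.
- move=> u /mapP[v vs ->]; rewrite mem_undup; apply/allpairsP.
  by exists (v, val e); split => //=; exact: valP.
- by move=> v; rewrite mulr_ge0 ?walk_prob_ge0 ?jump_prob_ge0.
Qed.

Lemma walk_prob_le1 (w : env_path ne) n v : walk_prob w n v <= 1.
Proof. by have := @walk_prob_sum_le1 w n [:: v] isT; rewrite big_seq1. Qed.

Lemma open_measurable_env (A : set OmegaN) :
  open (A : set (env_path ne)) -> measurable A.
Proof. by move=> oA; exact: sub_sigma_algebra. Qed.

Lemma continuous_measurable_env (f : env_path ne -> env_path ne) :
  continuous f -> forall A : set OmegaN,
  measurable A -> measurable (f @^-1` A : set OmegaN).
Proof.
move=> /continuousP cf A.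
apply: (@smallest_sub _ (sigma_algebra setT) (@open (env_path ne))
  [set A | measurable (f @^-1` A : set OmegaN)]).
  split.
  - by rewrite /= preimage_set0; exact: measurable0.
  - move=> B /= mB; rewrite setTD preimage_setC; exact: measurableC.
  - by move=> F /= mF; rewrite preimage_bigcup; exact: bigcupT_measurable.
by move=> B oB /=; apply: open_measurable_env; exact: cf.
Qed.

Lemma walk_prob_lt_measurable n v c :
  measurable ([set w | walk_prob w n v < c] : set OmegaN).
Proof.
apply: open_measurable_env.
have /continuousP cf := @walk_prob_continuous R d J kappa ne n v.
exact: cf (@open_lt _ c).
Qed.

Hypothesis ergodicP : ergodic_shifts P.

Lemma env_shift_byS n x y (w : env_path ne) :
  env_shift_by n x (env_shift y w) = env_shift_by n.+1 (x + y) w.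
Proof. by rewrite -[env_shift y w]/(env_shift_by 1 y w) env_shift_byD add1n addrC. Qed.

Lemma env_shift_by_measurable n x (A : set OmegaN) :
  measurable A -> measurable (env_shift_by n x @^-1` A : set OmegaN).
Proof. by move=> mA; apply: continuous_measurable_env mA; exact: env_shift_by_continuous. Qed.

Lemma env_shift_by_preserving n v (A : set OmegaN) :
  v \in nstep J n -> measurable A -> P (env_shift_by n v @^-1` A) = P A.
Proof.
elim: n v => [v|n IH v].
  rewrite nstep0 => /eqP -> _; congr (P _); apply/funext => w /=.
  by rewrite /preimage/= env_shift_by0.
move=> /nstepS[x [e [xn eJ ->]]] mA; rewrite -(IH x xn mA).
rewrite -[RHS](ergodicP.1 e eJ); last exact: env_shift_by_measurable.
by congr (P _); apply/funext => w; rewrite /preimage/= -env_shift_byS.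
Qed.

(* The environments all of whose shifts lie in A form a strictly invariant set, which
   differs from A by a null set. *)
Lemma shift_subinvariant_01 (A : set OmegaN) : measurable A ->
  (forall x, x \in J -> env_shift x @^-1` A `<=` A) -> P A = 0%E \/ P A = 1%E.
Proof.
move=> mA subA.
have shiftA n v : v \in nstep J n -> env_shift_by n v @^-1` A `<=` A.
  elim: n v => [v|n IH v].
    by rewrite nstep0 => /eqP -> w /=; rewrite env_shift_by0.
  move=> /nstepS[x [e [xn eJ ->]]] w; rewrite /preimage/= -env_shift_byS => h.
  by apply: (subA e eJ); exact: IH h.
pose C n : set OmegaN := \big[setI/setT]_(v <- nstep J n) (env_shift_by n v @^-1` A).
pose B := \bigcap_n C n.
have BP w : B w <-> forall n v, v \in nstep J n -> A (env_shift_by n v w).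
  split=> [Bw n v vn|h n _].
    by have := Bw n I; rewrite /C -bigcap_seq => /(_ v vn).
  by rewrite /C -bigcap_seq => v vn; exact: h.
have mS n v : measurable (env_shift_by n v @^-1` A : set OmegaN) by exact: env_shift_by_measurable.
have mC n : measurable (C n) by exact: bigsetI_measurable.
have mB : measurable B by exact: bigcapT_measurable.
have PBA : P B = P A.
  have PS n v : v \in nstep J n -> P (A `\` env_shift_by n v @^-1` A) = 0%E.
    move=> vn; rewrite measureD ?(le_lt_trans (probability_le1 _ _)) ?ltry//.
    have /setIidPr -> := shiftA n v vn.
    transitivity (P A - P A)%E; last by rewrite subee// fin_num_measure.
    by congr (_ - _)%E; exact: env_shift_by_preserving.
  (* Enumerating the lattice by [unpickle] makes the exceptional set a countable union of null
     sets. *)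
  pose Z n m : set OmegaN :=
    if @choice.unpickle 'rV[int]_d m is Some v then
    if v \in nstep J n then A `\` env_shift_by n v @^-1` A else set0 else set0.
  have Z0 : P.-negligible (\bigcup_n \bigcup_m Z n m).
    apply: negligible_bigcup => n; apply: negligible_bigcup => m.
    rewrite /Z; case: (choice.unpickle m) => [v|]; last exact: negligible_set0.
    case: ifPn => vn; last exact: negligible_set0.
    by apply/negligibleP; [exact: measurableD|exact: PS].
  have : P.-negligible (A `\` B).
    apply: negligibleS Z0 => w [Aw]; apply: contra_notP => h; apply/BP => n v vn.
    apply: contra_notP h => nA; exists n => //; exists (choice.pickle v) => //.
    by rewrite /Z choice.pickleK vn.
  move=> /negligibleP -/(_ (measurableD mA mB)) PAB.
  have BA : B `<=` A by move=> w /BP/(_ 0%N 0); rewrite nstep0 env_shift_by0; apply.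
  rewrite (measureDI P mA mB) setIidr// PAB add0e//.
rewrite -PBA; apply: ergodicP.2 => // x xJ; apply/seteqP; split => w.
  (* This inclusion is the substantial one: membership in [A] at [(n.+1, v + x)] is brought back to
     [(n, v)] by [subA]. *)
  move=> /BP h; apply/BP => n v vn; apply: (subA x xJ).
  have := h n v vn; rewrite /preimage/= env_shift_byS.
  by rewrite -[env_shift x _]/(env_shift_by 1 x _) env_shift_byD addn1.
move=> /BP h; apply/BP => n v vn; rewrite env_shift_byS; apply: h.
by apply/nstepS; exists v, x.
Qed.

End ergodic_rate.

(** * Directional rates *)

(** Convergence of [g n / n] to [L], with the division cleared so that it reads as a pair of linear
    bounds. *)
Definition grows (R : realType) (g : nat -> R) (L : R) :=
  forall e, 0 < e -> exists N, forall n, (N <= n)%N ->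
    (L - e) * n%:R <= g n <= (L + e) * n%:R.

Section directional_rate.
Context {R : realType} {d : nat} (J : {fset 'rV[int]_d}) (kappa : R).
Variable ne : elliptic_simplex J kappa !=set0.
Hypothesis kappa_gt0 : 0 < kappa.
Hypothesis kappa_le1 : kappa <= 1.
Hypothesis Jsym : forall e, e \in J -> - e \in J.
Variable e0 : 'rV[int]_d.
Hypothesis e0J : e0 \in J.
Variable P : probability (borelType (env_path ne)) R.
Hypothesis ergodicP : ergodic_shifts P.
Local Notation hull := (scaled_hull J (@embed R d)).
Local Notation OmegaN := (borelType (env_path ne)).
Implicit Types (w : env_path ne).

(** The strict [r < k%:R] expresses that [u / k] is interior: [k%:R - r] is the slack per block
    available for corrections. *)
Definition direction k u := [/\ (0 < k)%N, u \in nstep J k &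
  exists2 r, r < k%:R & hull r (embed u)].

Definition log_walk k u w n := ln (walk_prob w (n * k) (u *+ n)).

Lemma directionD k1 u1 k2 u2 : direction k1 u1 -> direction k2 u2 ->
  direction (k1 + k2) (u1 + u2).
Proof.
move=> [k1_gt0 u1k [r1 r1k h1]] [k2_gt0 u2k [r2 r2k h2]]; split.
- by rewrite addn_gt0 k1_gt0.
- exact: nstepD.
- by exists (r1 + r2); [rewrite natrD ltrD|rewrite embedD; exact: shullD].
Qed.

Lemma ln_kappa_le0 : ln kappa <= 0. Proof. exact: ln_le0. Qed.

Lemma walk_prob_gt0 w n v : v \in nstep J n -> 0 < walk_prob w n v.
Proof. by move=> /(walk_prob_ge kappa_gt0 w); apply: lt_le_trans; rewrite exprn_gt0. Qed.

Lemma ln_walk_prob_ge w n v : v \in nstep J n ->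
  n%:R * ln kappa <= ln (walk_prob w n v).
Proof.
move=> vn; rewrite mulr_natl -lnXn// ler_ln ?posrE ?exprn_gt0// ?walk_prob_gt0//.
exact: walk_prob_ge.
Qed.

Lemma ln_walk_prob_le0 w n v : ln (walk_prob w n v) <= 0.
Proof. by apply: ln_le0; exact: walk_prob_le1. Qed.

Lemma ln_walk_probD w m n x y : x \in nstep J m -> y \in nstep J n ->
  ln (walk_prob w m x) + ln (walk_prob (env_shift_by m x w) n y)
  <= ln (walk_prob w (m + n) (x + y)).
Proof.
move=> xm yn; rewrite -lnM ?posrE ?walk_prob_gt0//.
by rewrite ler_ln ?posrE ?mulr_gt0 ?walk_prob_gt0 ?nstepD//; exact: walk_probM_le.
Qed.

Lemma log_walk_ge_measurable k u n a : u \in nstep J k ->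
  measurable ([set w | a <= log_walk k u w n] : set OmegaN).
Proof.
move=> uk; pose A : set OmegaN := [set w | walk_prob w (n * k) (u *+ n) < expR a].
have mA : measurable A by exact: walk_prob_lt_measurable.
suff -> : [set w | a <= log_walk k u w n] = ~` A by exact: measurableC.
have pos w : 0 < walk_prob w (n * k) (u *+ n) by rewrite walk_prob_gt0// nstepMn.
apply/seteqP; split => w; rewrite /A /log_walk /= -ler_expR lnK ?posrE// leNgt.
  by move/negP.
by move=> h; apply/negP.
Qed.

Section fixed_direction.
Variables (k : nat) (u : 'rV[int]_d).
Hypothesis uk : direction k u.

Let unk : u \in nstep J k. Proof. by case: uk. Qed.
Let K : R := - (k%:R * ln kappa).
Let K0 : 0 <= K. Proof. by rewrite oppr_ge0 mulr_ge0_le0// ln_kappa_le0. Qed.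

(** Up to the boundary level, the event that the limsup of [log_walk k u w n / n] is at least [c];
    the strict [N < n] provides a positive [n] already for [N = 0]. *)
Let often (c : R) : set OmegaN :=
  \bigcap_N \bigcup_(n in [set n | (N < n)%N]) [set w | c * n%:R <= log_walk k u w n].

Let oftenP c w : often c w <-> forall N, exists2 n, (N < n)%N & c * n%:R <= log_walk k u w n.
Proof. by split=> [h N|h N _]; [have [n] := h N I; exists n|have [n] := h N; exists n]. Qed.

Let often_measurable c : measurable (often c).
Proof.
apply: bigcapT_measurable => N; apply: bigcup_measurable => n _.
exact: log_walk_ge_measurable.
Qed.

Let often_le c c' : c' <= c -> often c `<=` often c'.
Proof.
move=> cc w /oftenP h; apply/oftenP => N; have [n Nn cn] := h N.
by exists n => //; apply: le_trans cn; rewrite ler_wpM2r.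
Qed.

(* Make the step x first, follow the shifted path, and spend j extra blocks on returning
   to the multiples of u; u / k being interior leaves room for this correction. *)
Let often_shift c c' x w : x \in J -> c' < c ->
  often c (env_shift x w) -> often c' w.
Proof.
move=> xJ cc /oftenP h; apply/oftenP => N.
have [M HM] := @nstep_control d J Jsym e0 e0J R.
have [r rk hr] := let: And3 _ _ h := uk in h.
(* The slack of [j] blocks must cover the first step, its undoing and the delay [M]; [j] does not
   depend on [n], so the whole detour has bounded cost. *)
have [j /(_ j (leqnn j)) jP] : exists j, forall j', (j <= j')%N ->
    2 + M%:R <= (k%:R - r) * j'%:R by apply: eventually_le_mulrn; rewrite subr_gt0.
have r0 := shull_ge0 hr.
have jk0 : (0 < j * k)%N.
  rewrite lt0n; apply/eqP => jk0; have : (k%:R - r) * j%:R <= 0 :> R.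
    have := congr1 (fun n => n%:R : R) jk0; rewrite natrM => e.
    by rewrite mulrBl mulrC e sub0r oppr_le0 mulr_ge0.
  have : 0 <= M%:R :> R by []; lra.
have back : u *+ j - x \in nstep J (j * k).-1.
  apply: (HM _ _ (j%:R * r + 1)).
  (* Parity only: undoing [x] after [j] blocks takes one step more, while one step fewer is
     available. *)
  - exists (j * k + 1)%N; split.
      by apply: nstepD; [exact: nstepMn|rewrite nstepN ?nstep1].
    by rewrite addn1 -{1}(prednK jk0) /= negbK.
  - rewrite embedB embedMn; apply: shullD; first exact: shullZ.
    by rewrite -embedN; apply: shull_gen; rewrite ?fset_uniq ?Jsym.
  - have : ((j * k).-1%:R : R) = j%:R * k%:R - 1.
      by rewrite -natrM -{2}(prednK jk0) -natr1 addrK.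
    move=> ->; rewrite mulrBl in jP; lra.
have cc0 : 0 < c - c' by rewrite subr_gt0.
have [N' HN'] := eventually_le_mulrn (`|c'| * j%:R + (j * k)%:R * - ln kappa) cc0.
have [n Nn cn] := h (N + N')%N.
exists (n + j)%N.
  exact: leq_trans (leq_ltn_trans (leq_addr _ _) Nn) (leq_addr _ _).
have nB := HN' n (leq_trans (leq_addl _ _) (ltnW Nn)).
have step1 := @ln_walk_probD w 1 (n * k) x (u *+ n).
have step2 := @ln_walk_probD w (1 + n * k) (j * k).-1 (x + u *+ n) (u *+ j - x).
have lx := @ln_walk_prob_ge w 1 x.
have lb := @ln_walk_prob_ge (env_shift_by (1 + n * k) (x + u *+ n) w) (j * k).-1 (u *+ j - x).
rewrite !nstep1 !nstepMn// xJ in step1 lx.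
rewrite nstepD ?nstep1 ?nstepMn// back in step2.
rewrite back in lb.
have {}step1 := step1 isT isT; have {}step2 := step2 isT isT.
have {}lx := lx isT; have {}lb := lb isT.
have -> : log_walk k u w (n + j) =
    ln (walk_prob w (1 + n * k + (j * k).-1) (x + u *+ n + (u *+ j - x))).
  rewrite /log_walk; congr (ln (walk_prob _ _ _)); last first.
    by rewrite mulrnDr (addrC x) -addrA subrKC.
  by rewrite mulnDl -[(j * k)%N in LHS](prednK jk0) addnS add1n addSn.
apply: le_trans step2; rewrite -/(env_shift x w) in cn.
have cn' : c * n%:R <= ln (walk_prob (env_shift_by 1 x w) (n * k) (u *+ n)) by [].
have e1 : (j * k)%:R * ln kappa = 1%:R * ln kappa + (j * k).-1%:R * ln kappa.
  by rewrite -{1}(prednK jk0) -natr1 mulrDl addrC.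
have c'j : c' * j%:R <= `|c'| * j%:R by rewrite ler_wpM2r// ler_norm.
rewrite natrD mulrDr; lra.
Qed.

(** Since [often_shift] loses an arbitrarily small amount of rate, it does not make [often c]
    subinvariant; intersecting over the levels below [c] repairs this. *)
Let nearly_often (c : R) := \bigcap_i often (c - i.+1%:R^-1).

Let nearly_often_01 c : P (nearly_often c) = 0%E \/ P (nearly_often c) = 1%E.
Proof.
apply: shift_subinvariant_01 => //; first exact: bigcapT_measurable.
move=> x xJ w h i _; apply: (often_shift xJ) (h i.+1 I).
by rewrite ltrD2l ltrN2 ltf_pV2 ?posrE// ltr_nat.
Qed.

Let log_walk_ge w n : - (K * n%:R) <= log_walk k u w n.
Proof.
have := ln_walk_prob_ge w (nstepMn n unk); rewrite natrM.
by have -> : - (K * n%:R) = n%:R * k%:R * ln kappa by rewrite /K; ring.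
Qed.

Lemma rate_exists : exists L, [/\ k%:R * ln kappa <= L, L <= 0 &
  {ae P, forall w, grows (log_walk k u w) L}].
Proof.
(* The supremum of [S] is the almost sure value of the limsup; by the zero-one law, levels outside
   [S] have probability zero. *)
pose S := [set c | P (nearly_often c) = 1%E].
have SK : S (- K).
  rewrite /S /= (_ : nearly_often _ = setT) ?probability_setT//.
  apply/seteqP; split => // w _ i _; apply: (@often_le (- K)).
    by rewrite lerBlDr lerDl invr_ge0.
  by apply/oftenP => N; exists N.+1 => //; rewrite mulNr; exact: log_walk_ge.
have S0 : ubound S 0.
  move=> c Sc; rewrite leNgt; apply/negP => c0.
  suff n0 : nearly_often c = set0.
    by move: Sc; rewrite /S/= n0 measure0 => /esym/eqP; rewrite onee_eq0.
  apply/seteqP; split => // w h.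
  have [i ic] := exists_invn_lt c0.
  have /oftenP/(_ 0%N)[n n0] := h i I; rewrite leNgt => /negP; apply.
  apply: le_lt_trans (ln_walk_prob_le0 _ _ _) _.
  by rewrite mulr_gt0 ?ltr0n// subr_gt0.
have hS : has_sup S by split; [exists (- K)|exists 0].
exists (sup S); split.
- by rewrite -[leLHS]opprK; exact: sup_upper_bound.
- by apply: ge_sup => //; exists (- K).
have key e : 0 < e -> {ae P, forall w, exists N, forall n, (N <= n)%N ->
    (sup S - e) * n%:R <= log_walk k u w n <= (sup S + e) * n%:R}.
  move=> e_gt0.
  have lower : {ae P, forall w, exists N, forall n, (N <= n)%N ->
      (sup S - e / 2 - e / 2) * n%:R <= log_walk k u w n}.
    (* [superadditive_liminf] requires a level of at least [- K]; below it the crude bound by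
       ellipticity suffices. *)
    have [small|big] := ltP (sup S - e / 2) (- K).
      apply: aeW => w; exists 0%N => n _; apply: le_trans (log_walk_ge _ _).
      by rewrite -[leRHS]mulNr ler_wpM2r//; lra.
    apply: (@superadditive_liminf _ OmegaN R P (env_shift_by k u) _ _
      (fun n w => log_walk k u w n) K (sup S - e / 2)) => //.
    - by move=> A mA; exact: env_shift_by_measurable.
    - by move=> A mA; exact: env_shift_by_preserving.
    - move=> m n w; rewrite iter_env_shift_by /log_walk mulnDl mulrnDr.
      by apply: ln_walk_probD; exact: nstepMn.
    - by move=> n a; exact: log_walk_ge_measurable.
    - have [c Sc ec] := sup_adherent (divr_gt0 e_gt0 (ltr0n R 2)) hS.
      have [i ic] : exists i : nat, i.+1%:R^-1 < c - (sup S - e / 2).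
        by apply: exists_invn_lt; rewrite subr_gt0.
      have : P.-negligible (~` nearly_often c).
        by apply: negligible_setC => //; exact: bigcapT_measurable.
      apply: negligibleS => w /=; apply: contra_not => /(_ i I)/oftenP/(_ 0%N)[n n0 cn].
      exists n; split=> //; apply: le_trans cn; rewrite ler_wpM2r//.
      by rewrite lerBrDr -lerBrDl ltW.
    - exact: divr_gt0.
  have upper : {ae P, forall w, exists N, forall n, (N <= n)%N ->
      log_walk k u w n <= (sup S + e) * n%:R}.
    have nS : ~ S (sup S + e) by move=> /(sup_upper_bound hS); lra.
    have [P0|//] := nearly_often_01 (sup S + e).
    have : P.-negligible (nearly_often (sup S + e)).
      by apply/negligibleP => //; exact: bigcapT_measurable.
    apply: negligibleS => w /= h i _; apply/oftenP => N.
    apply: contra_notP h => h; exists N.+1 => n Nn; rewrite leNgt; apply/negP => /ltW cn.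
    apply: h; exists n => //; apply: le_trans cn; rewrite ler_wpM2r//.
    by rewrite lerBlDr lerDl invr_ge0.
  apply: aeS2 lower upper => w [N1 h1] [N2 h2].
  exists (maxn N1 N2) => n; rewrite geq_max => /andP[n1 n2].
  by rewrite h2// andbT (_ : sup S - e = sup S - e / 2 - e / 2) ?h1//; lra.
(* Only countably many tolerances may be combined under an almost sure quantifier. *)
have : {ae P, forall w (i : nat), exists N, forall n, (N <= n)%N ->
    (sup S - i.+1%:R^-1) * n%:R <= log_walk k u w n <= (sup S + i.+1%:R^-1) * n%:R}.
  by apply: ae_foralln => i; exact: key.
apply: aeS => w h e e_gt0.
have [i ie] := exists_invn_lt e_gt0.
have [N hN] := h i; exists N => n /hN/andP[h1 h2]; apply/andP; split.
  by apply: le_trans h1; rewrite ler_wpM2r// lerD2l lerN2 ltW.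
by apply: le_trans h2 _; rewrite ler_wpM2r// lerD2l ltW.
Qed.

End fixed_direction.

(* The second leg starts at a moving space-time point, so that almost sure convergence
   says nothing about it; convergence in probability does, by stationarity. *)
Lemma rate_superadditive k1 u1 k2 u2 L1 L2 L : direction k1 u1 -> direction k2 u2 ->
  {ae P, forall w, grows (log_walk k1 u1 w) L1} ->
  {ae P, forall w, grows (log_walk k2 u2 w) L2} ->
  {ae P, forall w, grows (log_walk (k1 + k2) (u1 + u2) w) L} -> L1 + L2 <= L.
Proof.
move=> D1 D2 g1 g2 g12.
have [k1_gt0 u1k _] := D1; have [k2_gt0 u2k _] := D2.
have [k12_gt0 u12k _] := directionD D1 D2.
(* Three bad events of probability below one quarter leave an environment outside all of them. *)
have q0 : 0 < 4^-1 :> R by rewrite invr_gt0.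
pose low k u l e n : set OmegaN := ~` [set w | (l - e) * n%:R <= log_walk k u w n].
pose upp e n : set OmegaN :=
  [set w | (L + e) * n%:R <= log_walk (k1 + k2) (u1 + u2) w n].
have mlow k u l e n : u \in nstep J k -> measurable (low k u l e n).
  by move=> uk; apply: measurableC; exact: log_walk_ge_measurable.
have mupp e n : measurable (upp e n) by exact: log_walk_ge_measurable.
have lower k u l e : u \in nstep J k -> {ae P, forall w, grows (log_walk k u w) l} ->
  0 < e -> exists N, forall n, (N <= n)%N -> (P (low k u l e n) < (4^-1)%:E)%E.
  move=> uk gl e_gt0.
  apply: eventually_probability_small => //; first by move=> n; exact: mlow.
  by apply: aeS gl => w /(_ e e_gt0)[N hN]; exists N => n /hN/andP[h _]; exact.
have upper e : 0 < e -> exists N, forall n, (N <= n)%N -> (P (upp e n) < (4^-1)%:E)%E.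
  move=> e_gt0; apply: eventually_probability_small => //.
  apply: aeS g12 => w /(_ (e / 2) (divr_gt0 e_gt0 (ltr0n R 2)))[N hN].
  exists N.+1 => n Nn h; have /andP[_ h'] := hN n (ltnW Nn).
  have n0 : 0 < n%:R :> R by rewrite ltr0n (leq_ltn_trans _ Nn).
  have := le_trans h h'; rewrite ler_pM2r//; lra.
rewrite leNgt; apply/negP => lt12.
(* Three errors of size [e] are made, so a quarter of the gap gives the contradiction. *)
pose e := (L1 + L2 - L) / 4.
have e_gt0 : 0 < e by rewrite divr_gt0// subr_gt0.
have [N1 h1] := lower _ _ _ _ u1k g1 e_gt0.
have [N2 h2] := lower _ _ _ _ u2k g2 e_gt0.
have [N3 h3] := upper _ e_gt0.
pose n := (maxn N1 (maxn N2 N3)).+1.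
have {}h1 := h1 n ltac:(by rewrite leqW// leq_maxl).
have {}h2 := h2 n ltac:(by rewrite leqW// leq_max leq_maxl orbT).
have {}h3 := h3 n ltac:(by rewrite leqW// !leq_max leqnn !orbT).
set A1 := low _ _ _ _ _ in h1; set A2 := low _ _ _ _ _ in h2.
set A3 := upp _ _ in h3.
have mA1 : measurable A1 by exact: mlow.
have mA2 : measurable A2 by exact: mlow.
have mA3 : measurable A3 by exact: mupp.
(* The bad event of the second leg, seen from the end of the first; stationarity gives it the
   probability of [A2]. *)
pose A2' : set OmegaN := env_shift_by (n * k1) (u1 *+ n) @^-1` A2.
have mA2' : measurable A2' by exact: env_shift_by_measurable.
have PA2' : (P A2' < (4^-1)%:E)%E.
  by rewrite env_shift_by_preserving//; exact: nstepMn.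
have [w nw] : exists w : OmegaN, ~ (A1 `|` A2' `|` A3) w.
  apply/existsNP => all; have : (P setT < 1)%E.
    have -> : [set: OmegaN] = A1 `|` A2' `|` A3.
      by apply/seteqP; split => // w _; exact: all.
    apply: (@le_lt_trans _ _ (P A1 + P A2' + P A3)%E).
      apply: le_trans (measureU2 _ _ _) _ => //; first exact: measurableU.
      by rewrite leeD2r// measureU2.
    have fin (A : set OmegaN) : measurable A -> P A = (fine (P A))%:E.
      by move=> mA; rewrite fineK// fin_num_measure.
    move: h1 PA2' h3; rewrite (fin _ mA1) (fin _ mA2') (fin _ mA3) -!EFinD !lte_fin.
    by lra.
  by rewrite probability_setT ltxx.
have w1 : (L1 - e) * n%:R <= log_walk k1 u1 w n.
  by apply: contra_notT nw => /negP h; left; left.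
have w2 : (L2 - e) * n%:R <= log_walk k2 u2 (env_shift_by (n * k1) (u1 *+ n) w) n.
  by apply: contra_notT nw => /negP h; left; right.
have w3 : log_walk (k1 + k2) (u1 + u2) w n < (L + e) * n%:R.
  by rewrite ltNge; apply: contra_notN nw => h; right.
have w12 := ln_walk_probD w (nstepMn n u1k) (nstepMn n u2k).
have : (L1 - e) * n%:R + (L2 - e) * n%:R < (L + e) * n%:R.
  apply: le_lt_trans w3; apply: le_trans (lerD w1 w2) _.
  by rewrite /log_walk mulnDr mulrnDl.
rewrite -mulrDl ltr_pM2r ?ltr0n// /e; lra.
Qed.

Lemma directional_rates : exists L : nat -> 'rV[int]_d -> R, [/\
  forall k u, direction k u -> k%:R * ln kappa <= L k u <= 0,
  forall k1 u1 k2 u2, direction k1 u1 -> direction k2 u2 ->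
    L k1 u1 + L k2 u2 <= L (k1 + k2)%N (u1 + u2) &
  {ae P, forall w, forall k u, direction k u -> grows (log_walk k u w) (L k u)}].
Proof.
have /choice[L LP] (p : nat * 'rV[int]_d) : exists l, direction p.1 p.2 ->
    [/\ p.1%:R * ln kappa <= l, l <= 0 &
      {ae P, forall w, grows (log_walk p.1 p.2 w) l}].
  have [D|nD] := pselect (direction p.1 p.2); last by exists 0.
  by have [l hl] := rate_exists D; exists l.
exists (fun k u => L (k, u)); split.
- by move=> k u /(LP (k, u))[-> ->].
- move=> k1 u1 k2 u2 D1 D2; have [_ _ g1] := LP (k1, u1) D1.
  have [_ _ g2] := LP (k2, u2) D2; have [_ _ g] := LP (_, _) (directionD D1 D2).
  exact: rate_superadditive D1 D2 g1 g2 g.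
- pose good (i : nat) (w : OmegaN) :=
    if @choice.unpickle (nat * 'rV[int]_d)%type i is Some p
    then direction p.1 p.2 -> grows (log_walk p.1 p.2 w) (L p) else True.
  have : {ae P, forall w, forall i, good i w}.
    apply: ae_foralln => i; rewrite /good; case: choice.unpickle => [p|]; last exact: aeW.
    have [D|nD] := pselect (direction p.1 p.2); last by apply: aeW.
    by have [_ _] := LP p D; apply: aeS => w g _.
  apply: aeS => w h k u D; have := h (choice.pickle (k, u)).
  by rewrite /good choice.pickleK; exact.
Qed.

End directional_rate.

(** * Comparison with the quenched law *)

Section quenched.
Context {R : realType} {d : nat} (J : {fset 'rV[int]_d}) (kappa : R).
Variable ne : elliptic_simplex J kappa !=set0.
Hypothesis kappa_gt0 : 0 < kappa.
Variable w : env_path ne.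
Local Notation walks := (g_sigma_algebraType (@walk_cylinders d)).
Variable P : probability walks R.
Hypothesis quenchedP : quenched_law w 0 P.

Lemma measurable_site n x : measurable ([set X | X n = x] : set walks).
Proof. by apply: sub_sigma_algebra; exists n, x. Qed.

Lemma measurable_position n (A : set 'rV[int]_d) :
  measurable ([set X | A (X n)] : set walks).
Proof.
rewrite (_ : [set X | _] = \bigcup_k
    (if @choice.unpickle 'rV[int]_d k is Some x then
       if `[< A x >] then [set X | X n = x] else set0 else set0)).
  apply: bigcupT_measurable => k; case: choice.unpickle => [x|//].
  by case: ifP => // _; exact: measurable_site.
apply/seteqP; split => X /=.
  by move=> AX; exists (choice.pickle (X n)) => //; rewrite choice.pickleK; case: asboolP.
by move=> [k _]; case: choice.unpickle => [x|//]; case: asboolP => // Ax ->.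
Qed.

Lemma measurable_prefix n (s : nat -> 'rV[int]_d) :
  measurable ([set X | forall i, (i <= n)%N -> X i = s i] : set walks).
Proof.
rewrite (_ : [set X | _] = \bigcap_(i in [set i | (i <= n)%N]) [set X | X i = s i]) //.
by apply: bigcap_measurable => [|i _]; [exists 0%N|exact: measurable_site].
Qed.

(** The law is prescribed only along complete prefixes, so [X n = u] is cut into the countably many
    prefixes ending at [u], indexed by their code. *)
Lemma quenched_step n u (e : J) :
  (P [set X | X n = u /\ X n.+1 = (u + val e)%R] =
   P [set X | X n = u] * (jump_prob w n u e)%:E)%E.
Proof.
pose D k : set walks :=
  [set X | X n = u /\ choice.pickle (mkseq X n.+1) = k].
pose E : set walks := [set X | X n.+1 = u + val e].
have DP k : D k = set0 \/ exists2 s, s n = u &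
    D k = [set X | forall i, (i <= n)%N -> X i = s i].
  have [->|/set0P[s [sn sk]]] := eqVneq (D k) set0; [by left|right].
  exists s => //; apply/seteqP; split => X /=.
    move=> [Xn Xk] i ni; rewrite -sk in Xk.
    have Xs := pcan_inj (@choice.pickleK _) Xk.
    by have := congr1 (fun t => nth 0 t i) Xs; rewrite !nth_mkseq.
  move=> Xs; have e' : mkseq X n.+1 = mkseq s n.+1.
    by apply/eq_in_map => i; rewrite mem_iota => /andP[_ ni]; exact: Xs.
  split; [exact: etrans (Xs n (leqnn n)) sn|].
  exact: etrans (congr1 choice.pickle e') sk.
have mD k : measurable (D k).
  by have [->|[s _ ->]] := DP k; [exact: measurable0|exact: measurable_prefix].
have mE : measurable E by exact: measurable_site.
have DE k : (P (D k `&` E) = (jump_prob w n u e)%:E * P (D k))%E.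
  have [->|[s sn ->]] := DP k; first by rewrite set0I measure0 mule0.
  by rewrite muleC /E -sn; exact: quenchedP.2.
have tD : trivIset setT D by move=> i j _ _ [X [[_ <-] [_ <-]]].
have tDE : trivIset setT (fun k => D k `&` E).
  by move=> i j _ _ [X [[[_ <-] _] [[_ <-] _]]].
rewrite (_ : [set X | X n = u] = \bigcup_k D k); last first.
  by apply/seteqP; split => X /=; [move=> Xn; exists (choice.pickle (mkseq X n.+1))|case=> k _ []].
rewrite (_ : [set X | _] = \bigcup_k (D k `&` E)); last first.
  apply/seteqP; split => X /=; last by case=> k _ [[]].
  by move=> [Xn XE]; exists (choice.pickle (mkseq X n.+1)).
rewrite !measure_bigcup//; last by move=> k _; exact: measurableI.
by rewrite muleC -nneseriesZl//; apply: eq_eseriesr => k _; exact: DE.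
Qed.

Lemma walk_prob_le_quenched n v : ((walk_prob w n v)%:E <= P [set X | X n = v])%E.
Proof.
elim: n v => [|n IH] v.
  rewrite /=; case: eqVneq => [->|_]; last exact: measure_ge0.
  by rewrite quenchedP.1.
pose F e : set walks := [set X | X n = v - e /\ X n.+1 = v].
have mF e : measurable (F e).
  by apply: measurableI; exact: measurable_site.
apply: (@le_trans _ _ (P (\big[setU/set0]_(e <- J) F e))); last first.
  apply: le_measure; rewrite ?inE; first by apply: bigsetU_measurable.
    exact: measurable_site.
  by rewrite -bigcup_seq => X [e _ []].
rewrite measure_fbigsetU//; last first.
  move=> e e' _ _ [X [[h1 _] [h2 _]]].
  by apply/oppr_inj/(addrI v); rewrite -h1 -h2.
rewrite big_seq_fsetE /= -sumEFin; apply: lee_sum => e _.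
rewrite EFinM [X in (_ <= P X)%E](_ : _ =
    [set X | X n = v - val e /\ X n.+1 = v - val e + val e]); last by rewrite subrK.
by rewrite quenched_step lee_wpmul2r// lee_fin jump_prob_ge0.
Qed.

(** By complement: the reachable sites outside [A] carry at least their [walk_prob], and the total
    of [walk_prob] over reachable sites is at least one. *)
Lemma quenched_position_le n (A : set 'rV[int]_d) :
  (P [set X | A (X n)] <=
   (\sum_(v <- nstep J n | `[< A v >]) walk_prob w n v)%:E)%E.
Proof.
pose S := [fset v in nstep J n | ~~ `[< A v >]]%fset.
have SP : ((\sum_(v <- S) walk_prob w n v)%:E <= P (~` [set X | A (X n)]))%E.
  apply: (@le_trans _ _ (P (\big[setU/set0]_(v <- S) [set X | X n = v]))).
    rewrite measure_fbigsetU.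
    - by rewrite -sumEFin; apply: lee_sum => v _; exact: walk_prob_le_quenched.
    - by move=> v _; exact: measurable_site.
    - by move=> v v' _ _ [X [<- <-]].
  apply: le_measure; rewrite ?inE.
  - by apply: bigsetU_measurable => v _; exact: measurable_site.
  - by apply: measurableC; exact: measurable_position.
  - rewrite -bigcup_seq => X [v /= + Xv]; rewrite !inE => /andP[_ /asboolP].
    by rewrite Xv.
rewrite probability_setC in SP; last exact: measurable_position.
have fin : P [set X | A (X n)] \is a fin_num.
  by apply: fin_num_measure; exact: measurable_position.
rewrite -(fineK fin) in SP *; rewrite -EFinB !lee_fin in SP *.
have := walk_prob_sum_ge1 kappa_gt0 w n.
rewrite (bigID (fun v => `[< A v >])) /=.
have -> : \sum_(v <- nstep J n | ~~ `[< A v >]) walk_prob w n v =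
    \sum_(v <- S) walk_prob w n v.
  rewrite -big_filter; apply: perm_big; apply: uniq_perm.
  - by rewrite filter_uniq ?fset_uniq.
  - exact: fset_uniq.
  - by move=> v; rewrite mem_filter !inE andbC.
by lra.
Qed.

End quenched.

(** * The rate function *)

Section rate_function.
Context {R : realType} {d : nat} (J : {fset 'rV[int]_d}) (kappa : R).
Hypothesis kappa_le1 : kappa <= 1.
Hypothesis Jsym : forall e, e \in J -> - e \in J.
Variable e0 : 'rV[int]_d.
Hypothesis e0J : e0 \in J.
Local Notation hull := (scaled_hull J (@embed R d)).
Local Notation direction := (direction (R := R) J).
Variable C : R.
Hypothesis C_gt0 : 0 < C.
Hypothesis gauge : forall x, hull (C * `|x|) x.
Variable L : nat -> 'rV[int]_d -> R.
Hypothesis L_bounds : forall k u, direction k u -> k%:R * ln kappa <= L k u <= 0.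
Hypothesis L_superadditive : forall k1 u1 k2 u2, direction k1 u1 -> direction k2 u2 ->
  L k1 u1 + L k2 u2 <= L (k1 + k2)%N (u1 + u2).

Definition velocity (p : nat * 'rV[int]_d) : 'rV[R]_d := p.1%:R^-1 *: embed p.2.

Definition velocity_rate (p : nat * 'rV[int]_d) : R := - L p.1 p.2 / p.1%:R.

Definition local_rate x (r : R) : \bar R := ereal_inf [set (velocity_rate p)%:E | p in
  [set p | direction p.1 p.2 /\ `|velocity p - x| < r]].

(* The lower semicontinuous envelope of the rates of the interior lattice velocities. *)
Definition rate x : \bar R := ereal_sup [set local_rate x r | r in [set r | 0 < r]].

Lemma velocity_rate_bounds k u : direction k u ->
  0 <= velocity_rate (k, u) <= `|ln kappa|.
Proof.
move=> D; have [k0 _ _] := D; have /andP[lL uL] := L_bounds D.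
have k0' : 0 < k%:R :> R by rewrite ltr0n.
rewrite /velocity_rate /= divr_ge0 ?oppr_ge0//= ler_pdivrMr//.
by rewrite ler0_norm ?ln_le0// mulNr lerN2 mulrC.
Qed.

Lemma rate_leP x s : (rate x <= s%:E)%E <->
  (forall r e, 0 < r -> 0 < e -> exists p,
    [/\ direction p.1 p.2, `|velocity p - x| < r & velocity_rate p <= s + e]).
Proof.
split=> [xs r e r0 e0' |h].
  have : (local_rate x r < (s + e)%:E)%E.
    apply: (@le_lt_trans _ _ s%:E); last by rewrite lte_fin ltrDl.
    by apply: le_trans xs; apply: ereal_sup_ubound; exists r.
  move=> /ereal_inf_lt[_ [p [Dp px] <-]]; rewrite lte_fin => /ltW ps.
  by exists p.
apply: ge_ereal_sup => _ [r /= r0 <-]; apply/lee_addgt0Pr => e e_gt0.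
have [p [Dp px ps]] := h r e r0 e_gt0.
by apply: (@le_trans _ _ (velocity_rate p)%:E) => //; apply: ereal_inf_lbound; exists p.
Qed.

Lemma rate_gtP x a : (a%:E < rate x)%E -> exists2 r, 0 < r & (a%:E < local_rate x r)%E.
Proof. by move=> /ereal_sup_gt[_ [r r0 <-] ar]; exists r. Qed.

Lemma rate_lower_semicontinuous : lower_semicontinuous rate.
Proof.
move=> x a /rate_gtP[r r0 ar]; exists (ball x (r / 2)).
  by apply: nbhsx_ballx; rewrite divr_gt0.
move=> y; rewrite -ball_normE /= => xy.
apply: lt_le_trans ar _; apply: (@le_trans _ _ (local_rate y (r / 2))); last first.
  by apply: ereal_sup_ubound; exists (r / 2) => //=; rewrite divr_gt0.
apply: ereal_inf_le_tmp => _ [p [Dp py] <-]; exists p => //; split => //.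
rewrite -(subrKA y); apply: le_lt_trans (ler_normD _ _) _.
by rewrite (splitr r) ltrD// distrC.
Qed.

Lemma rate_ge0 x : (0 <= rate x)%E.
Proof.
apply: (@le_trans _ _ (local_rate x 1)); last by apply: ereal_sup_ubound; exists 1 => /=.
apply: le_ereal_inf_tmp => _ [[k u] [/= D _] <-].
by rewrite lee_fin; have /andP[] := velocity_rate_bounds D.
Qed.

Lemma direction_dense x r : hull 1 x -> 0 < r ->
  exists p, direction p.1 p.2 /\ `|velocity p - x| < r.
Proof.
move=> hx r0; have [K HK] := @nstep_target d J Jsym e0 e0J R.
(* Shrinking [x] by [1 - s] moves it by at most [r / 2] and frees [s * k] of the [k] steps, which
   absorb the gauge [C * K] of the rounding error. *)
pose s := Num.min (2^-1) (r / (2 * (`|x| + 1))).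
have s0 : 0 < s by rewrite lt_min invr_gt0 ltr0n/= divr_gt0// mulr_gt0// ltr_wpDl.
have s2 : s <= 2^-1 by rewrite ge_min lexx.
have sr : s * `|x| <= r / 2.
  have : s <= r / (2 * (`|x| + 1)) by rewrite ge_min lexx orbT.
  rewrite ler_pdivlMr ?mulr_gt0 ?ltr_wpDl// => h.
  have := normr_ge0 x; nra.
have hx' : hull 1 ((1 - s) *: x).
  rewrite -[X in hull X _]mul1r; apply: (@shull_le _ _ _ _ _ ((1 - s) * 1)).
    by rewrite ler_wpM2r// gerBl ltW.
  by apply: shullZ hx; lra.
have [N1 H1] := eventually_le_mulrn (C * K + 1) s0.
have [N2 H2] := eventually_le_mulrn (2 * K + 1) r0.
pose k := (maxn N1 N2).+1.
have {}H1 := H1 k (leqW (leq_maxl _ _)).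
have {}H2 := H2 k (leqW (leq_maxr _ _)).
have k0 : 0 < k%:R :> R by rewrite ltr0n.
have [u uk uK] := HK _ k hx'.
exists (k, u); split => /=.
  split => //; exists (k%:R * (1 - s) + C * K); first by rewrite mulrBr mulr1; lra.
  rewrite -(subrKC (k%:R *: ((1 - s) *: x)) (embed u)).
  apply: shullD.
    rewrite scalerA -[X in hull X _]mulr1; apply: shullZ => //.
    by rewrite mulr_ge0//; lra.
  by apply: shull_le (gauge _); rewrite ler_pM2l.
have -> : velocity (k, u) - x =
    k%:R^-1 *: (embed u - k%:R *: ((1 - s) *: x)) - s *: x.
  rewrite scalerBr scalerK ?gt_eqF// scalerBl scale1r /velocity/=.
  by apply/rowP => i; rewrite !mxE; ring.
apply: le_lt_trans (ler_normB _ _) _.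
rewrite !normrZ gtr0_norm ?invr_gt0// (gtr0_norm s0).
have : k%:R^-1 * `|embed u - k%:R *: ((1 - s) *: x)| < r / 2.
  rewrite mulrC ltr_pdivrMr//; lra.
lra.
Qed.

Lemma rate_le_hull x : hull 1 x -> (rate x <= `|ln kappa|%:E)%E.
Proof.
move=> hx; apply/rate_leP => r e r0 e_gt0.
have [[k u] [D px]] := direction_dense hx r0; exists (k, u); split => //.
have /andP[_ h] := velocity_rate_bounds D; apply: le_trans h _.
by rewrite lerDl ltW.
Qed.

Lemma velocity_hull p : direction p.1 p.2 -> hull 1 (velocity p).
Proof.
move=> [k0 uk _]; have := shullZ _ (nstep_shull R uk).
by move=> /(_ p.1%:R^-1); rewrite mulVf ?pnatr_eq0 -?lt0n//; apply; rewrite invr_ge0.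
Qed.

Lemma rate_notin_hull x : ~ hull 1 x -> rate x = +oo%E.
Proof.
move=> nx; case E : (rate x) => [s| |] //; last by have := rate_ge0 x; rewrite E.
have := closed_openC (@shull_closed d J R).
rewrite openE => /(_ x nx)/nbhs_ballP[r /= r0 h].
have /rate_leP/(_ r 1 r0 ltr01)[p [Dp px _]] : (rate x <= s%:E)%E by rewrite E.
exfalso; apply: (h (velocity p)); last exact: velocity_hull.
by rewrite -ball_normE /= distrC.
Qed.

Lemma direction_mul k u n : direction k u -> (0 < n)%N ->
  direction (n * k) (u *+ n) /\ n%:R * L k u <= L (n * k)%N (u *+ n).
Proof.
move=> D; elim: n => // -[_ _|n IH _]; first by rewrite mul1n mulr1n mul1r.
have [//|Dn Ln] := IH; rewrite mulSn mulrS; split; first exact: directionD.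
by apply: le_trans (L_superadditive D Dn); rewrite -natr1 mulrDl mul1r addrC lerD2l.
Qed.

(** The weight [t] is approximated by [n / N]; cross multiplication by [k2] and [k1] puts both
    directions on the common time unit [k1 * k2], where superadditivity applies. *)
Lemma velocity_rate_convex p q (t r e : R) : direction p.1 p.2 -> direction q.1 q.2 ->
  0 < t < 1 -> 0 < r -> 0 < e -> exists p', [/\ direction p'.1 p'.2,
    `|velocity p' - (t *: velocity p + (1 - t) *: velocity q)| < r &
    velocity_rate p' <= t * velocity_rate p + (1 - t) * velocity_rate q + e].
Proof.
case: p q => [k1 u1] [k2 u2] /= D1 D2 /andP[t0 t1] r0 e_gt0.
have /andP[r1_ge0 _] := velocity_rate_bounds D1.
have /andP[r2_ge0 _] := velocity_rate_bounds D2.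
pose v1 := velocity (k1, u1); pose v2 := velocity (k2, u2).
pose M := `|v1| + `|v2| + velocity_rate (k1, u1) + velocity_rate (k2, u2).
have M0 : 0 <= M by rewrite !addr_ge0.
have [N1 H1] := eventually_le_mulrn (M + 1) r0.
have [N2 H2] := eventually_le_mulrn (M + 1) e_gt0.
have [N3 H3] := eventually_le_mulrn 1 t0.
pose N := (maxn N1 (maxn N2 N3)).+1.
have {}H1 := H1 N (leqW (leq_maxl _ _)).
have {}H2 : M + 1 <= e * N%:R by apply: H2; rewrite /N leqW// leq_max leq_maxl orbT.
have {}H3 : 1 <= t * N%:R by apply: H3; rewrite /N leqW// !leq_max leqnn !orbT.
have N0 : 0 < N%:R :> R by rewrite ltr0n.
pose n := Num.truncn (t * N%:R).
have /truncn_itv/andP[nl nu] : 0 <= t * N%:R by rewrite mulr_ge0// ltW.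
rewrite -/n in nl nu; rewrite -natr1 in nu.
have n0 : (0 < n)%N by rewrite -(ltr_nat R); lra.
have nN : (n < N)%N by rewrite -(ltr_nat R); nra.
have [k1_gt0 _ _] := D1; have [k2_gt0 _ _] := D2.
have k1p : 0 < k1%:R :> R by rewrite ltr0n.
have k2p : 0 < k2%:R :> R by rewrite ltr0n.
have [E1 F1] := @direction_mul k1 u1 (n * k2)%N D1 ltac:(by rewrite muln_gt0 n0).
have [E2 F2] := @direction_mul k2 u2 ((N - n) * k1)%N D2
  ltac:(by rewrite muln_gt0 subn_gt0 nN).
have F := L_superadditive E1 E2.
have kE : (n * k2 * k1 + (N - n) * k1 * k2 = N * (k1 * k2))%N.
  by rewrite -!mulnA (mulnC k2) -mulnDl subnKC// ltnW.
pose s : R := n%:R / N%:R.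
have NnE : (N - n)%:R / N%:R = 1 - s :> R by rewrite natrB ?(ltnW nN)// mulrBl divff ?gt_eqF.
have st : `|s - t| <= N%:R^-1.
  have -> : s - t = (n%:R - t * N%:R) / N%:R by rewrite mulrBl mulfK ?gt_eqF.
  rewrite normrM (gtr0_norm (x := _^-1)) ?invr_gt0// ler_piMl ?invr_ge0//.
  by rewrite ler_norml; apply/andP; split; lra.
pose p := ((n * k2 * k1 + (N - n) * k1 * k2)%N, u1 *+ (n * k2) + u2 *+ ((N - n) * k1)).
exists p; split; first exact: directionD.
  have -> : velocity p
      = s *: v1 + (1 - s) *: v2.
    rewrite /p /velocity /= kE embedD !embedMn scalerDr !scalerA -NnE /s !natrM.
    by congr (_ *: _ + _ *: _); field; rewrite !gt_eqF.
  have -> : s *: v1 + (1 - s) *: v2 - (t *: v1 + (1 - t) *: v2) = (s - t) *: (v1 - v2).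
    rewrite scalerBr !scalerBl !scale1r !opprD !opprK.
    by apply/rowP => i; rewrite !mxE; ring.
  rewrite normrZ; apply: (@le_lt_trans _ _ (N%:R^-1 * M)).
    apply: ler_pM => //; apply: le_trans (ler_normB _ _) _.
    by rewrite /M -addrA lerDl addr_ge0.
  by rewrite mulrC ltr_pdivrMr//; lra.
have : velocity_rate p
   <= s * velocity_rate (k1, u1) + (1 - s) * velocity_rate (k2, u2).
  rewrite /p /velocity_rate /= {2}kE ler_pdivrMr ?ltr0n ?muln_gt0 ?k1_gt0//.
  have -> : (s * (- L k1 u1 / k1%:R) + (1 - s) * (- L k2 u2 / k2%:R)) * (N * (k1 * k2))%:R
      = - ((n * k2)%:R * L k1 u1 + ((N - n) * k1)%:R * L k2 u2).
    by rewrite -NnE /s !natrM; field; rewrite !gt_eqF.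
  by rewrite lerN2; apply: le_trans F; exact: lerD.
move=> /le_trans; apply.
have Ne : N%:R^-1 * M <= e by rewrite mulrC ler_pdivrMr//; lra.
have : `|(s - t) * (velocity_rate (k1, u1) - velocity_rate (k2, u2))| <= N%:R^-1 * M.
  rewrite normrM; apply: ler_pM => //; apply: le_trans (ler_normB _ _) _.
  rewrite !ger0_norm// /M -addrA lerDr addr_ge0//.
by have := ler_norm ((s - t) * (velocity_rate (k1, u1) - velocity_rate (k2, u2))); lra.
Qed.

Lemma rate_convex x y (t : R) : 0 <= t <= 1 ->
  (rate (t *: x + (1 - t) *: y)%R <= t%:E * rate x + (1 - t)%:E * rate y)%E.
Proof.
move=> /andP[t0 t1].
(* The endpoints are set apart because [velocity_rate_convex] uses both directions in positive
   proportion. *)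
have [->|tn0] := eqVneq t 0.
  by rewrite scale0r add0r subr0 scale1r mul0e add0e mul1e.
have [->|tn1] := eqVneq t 1.
  by rewrite subrr scale0r addr0 scale1r mul0e adde0 mul1e.
have t_gt0 : 0 < t by rewrite lt_neqAle eq_sym tn0.
have t_lt1 : 0 < 1 - t by rewrite subr_gt0 lt_neqAle tn1.
have [s|] := ltP (rate x) +oo%E; last first.
  rewrite leye_eq => /eqP ->; rewrite gt0_muley ?lte_fin// addye ?leey//.
  by rewrite -ltNye; apply: lt_le_trans (mule_ge0 _ (rate_ge0 _)); rewrite ?ltNyr// lee_fin ltW.
have [s'|] := ltP (rate y) +oo%E; last first.
  rewrite leye_eq => /eqP ->; rewrite (gt0_muley (x := (1 - t)%:E)) ?lte_fin// addey ?leey//.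
  by rewrite -ltNye; apply: lt_le_trans (mule_ge0 _ (rate_ge0 _)); rewrite ?ltNyr// lee_fin ltW.
have fx : rate x \is a fin_num by rewrite (ge0_fin_numE (rate_ge0 x)); exact: s.
have fy : rate y \is a fin_num by rewrite (ge0_fin_numE (rate_ge0 y)); exact: s'.
rewrite -(fineK fx) -(fineK fy) -!EFinM -EFinD.
apply/rate_leP => r e r0 e_gt0.
have e3 : 0 < e / 2 by rewrite divr_gt0.
have r3 : 0 < r / 2 by rewrite divr_gt0.
have /rate_leP/(_ _ _ r3 e3)[p [Dp px ps]] : (rate x <= (fine (rate x))%:E)%E.
  by rewrite (fineK fx) lexx.
have /rate_leP/(_ _ _ r3 e3)[q [Dq qy qs]] : (rate y <= (fine (rate y))%:E)%E.
  by rewrite (fineK fy) lexx.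
have t01 : 0 < t < 1 by rewrite t_gt0 -subr_gt0.
have [p' [Dp' pr pe]] := velocity_rate_convex Dp Dq t01 r3 e3.
exists p'; split => //.
  rewrite -(subrKA (t *: velocity p + (1 - t) *: velocity q)).
  apply: le_lt_trans (ler_normD _ _) _; rewrite (splitr r) ltrD//.
  have -> : t *: velocity p + (1 - t) *: velocity q - (t *: x + (1 - t) *: y) =
      t *: (velocity p - x) + (1 - t) *: (velocity q - y).
    by rewrite !scalerBr opprD addrACA.
  apply: le_lt_trans (ler_normD _ _) _; rewrite !normrZ !gtr0_norm//.
  have := ltr_pM2l t_gt0 (`|velocity p - x|) (r / 2).
  have := ltr_pM2l t_lt1 (`|velocity q - y|) (r / 2).
  by rewrite px qy; lra.
apply: le_trans pe _.
move: (ler_wpM2l (ltW t_gt0) ps) (ler_wpM2l (ltW t_lt1) qs).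
move: (fine (rate x)) (fine (rate y)) (velocity_rate p) (velocity_rate q).
by move=> a b a' b'; lra.
Qed.

Lemma rate_fin_num x : hull 1 x -> rate x \is a fin_num.
Proof.
move=> hx; rewrite ge0_fin_numE ?rate_ge0//.
by apply: le_lt_trans (rate_le_hull hx) _; rewrite ltry.
Qed.

(** The classical argument for a convex function bounded on a ball: [y] lies between [x] and a point
    beyond [y], and [x] lies between [y] and a point on the opposite side. *)
Lemma rate_continuous x : nbhs x (hull 1) -> {for x, continuous rate}.
Proof.
move=> /nbhs_ballP[r /= r0 xr].
have hx : hull 1 x by apply: xr; exact: ballxx.
have fx := rate_fin_num hx.
pose f y := fine (rate y).
have fE y : hull 1 y -> rate y = (f y)%:E by move=> hy; rewrite /f (fineK (rate_fin_num hy)).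
have f0 y : 0 <= f y by rewrite /f fine_ge0// rate_ge0.
pose K := `|ln kappa|.
have fK y : hull 1 y -> f y <= K by move=> hy; rewrite -lee_fin -fE// rate_le_hull.
have cf y z t : hull 1 y -> hull 1 z -> 0 <= t <= 1 -> hull 1 (t *: y + (1 - t) *: z) ->
    f (t *: y + (1 - t) *: z) <= t * f y + (1 - t) * f z.
  by move=> hy hz t01 hyz; have := rate_convex y z t01; rewrite !fE// -!EFinM -EFinD lee_fin.
suff : rate y @[y --> x] --> (f x)%:E by rewrite -(fE x hx).
apply: (@cvg_EFin R 'rV[R]_d (nbhs x) (nbhs_filter x) rate (f x)).
  change (nbhs x [set y | rate y \is a fin_num]).
  apply/nbhs_ballP; exists r; first exact: r0.
  by move=> y xy; apply: rate_fin_num; exact: xr.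
apply: (iffRL (@cvgrPdist_le R R 'rV[R]_d (nbhs x) (nbhs_filter x)
  (fine \o rate) (f x))) => e e_gt0.
change (nbhs x [set y | `|f x - f y| <= e]).
(* For [y] within [s * r] of [x], extrapolation by [s^-1] stays in the ball of radius [r], and the
   far point contributes at most [s * K <= e]. *)
pose s := Num.min 1 (e / (K + 1)).
have K0 : 0 <= K := normr_ge0 _.
have s0 : 0 < s by rewrite lt_min ltr01/= divr_gt0// ltr_wpDl.
have s1 : s <= 1 by rewrite ge_min lexx.
have sK : s * K <= e.
  have : s <= e / (K + 1) by rewrite ge_min lexx orbT.
  by rewrite ler_pdivlMr ?ltr_wpDl//; nra.
apply/nbhs_ballP; exists (s * r); first exact: mulr_gt0.
move=> y; rewrite -ball_normE /= => xy.
have hz (c : R) : `|c| = s^-1 -> hull 1 (x + c *: (y - x)).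
  move=> cs; apply: xr; rewrite -ball_normE /= opprD addNKr normrN normrZ cs distrC.
  by rewrite mulrC ltr_pdivrMr// mulrC.
have si : 0 < s^-1 by rewrite invr_gt0.
have hy : hull 1 y.
  apply: xr; rewrite -ball_normE /=; apply: lt_le_trans xy _.
  by rewrite ler_piMl// ltW.
have y_eq : y = (1 - s) *: x + (1 - (1 - s)) *: (x + s^-1 *: (y - x)).
  by apply/rowP => i; rewrite !mxE; field; rewrite gt_eqF.
pose t := (1 + s)^-1.
have s1p : 0 < 1 + s by rewrite addr_gt0.
have t01 : 0 <= t <= 1 by rewrite invr_ge0 ltW//= invf_le1// lerDl ltW.
have x_eq : x = t *: y + (1 - t) *: (x + (- s^-1) *: (y - x)).
  by apply/rowP => i; rewrite !mxE /t; field; rewrite !gt_eqF.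
have perturb (a b c t' : R) : 0 <= a -> c <= K -> 0 <= t' <= s ->
    b <= (1 - t') * a + t' * c -> b <= a + e.
  move=> a0 cK /andP[t'0 t's] h.
  have := ler_wpM2l t'0 cK; have := ler_wpM2r K0 t's; have := mulr_ge0 t'0 a0.
  by move: h sK; rewrite mulrBl mul1r; move: (s * K) => sK'; lra.
have hz1 := hz s^-1 (gtr0_norm si).
have hz2 : hull 1 (x + - s^-1 *: (y - x)) by apply: hz; rewrite normrN gtr0_norm.
have h1 : f y <= f x + e.
  apply: (@perturb _ _ (f (x + s^-1 *: (y - x))) s);
    [exact: f0|exact: fK|by rewrite (ltW s0) lexx|].
  rewrite -{2}(subKr 1 s) {1}y_eq; apply: cf => //; last by rewrite -y_eq.
  by rewrite subr_ge0 s1 gerBl ltW.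
have h2 : f x <= f y + e.
  apply: (@perturb _ _ (f (x + - s^-1 *: (y - x))) (1 - t)); [exact: f0|exact: fK| |].
    rewrite subr_ge0; have /andP[_ ->] := t01; rewrite /=.
    have -> : 1 - t = s * t by rewrite /t; field; rewrite gt_eqF.
    by rewrite ler_piMr ?(ltW s0)//; have /andP[] := t01.
  by rewrite subKr {1}x_eq; apply: cf => //; rewrite -x_eq.
by rewrite ler_distl lerBlDr h2 h1.
Qed.

End rate_function.

(** * Large deviation bounds *)

Section ldp_bounds.
Context {R : realType} {d : nat} (J : {fset 'rV[int]_d}) (kappa : R).
Variable ne : elliptic_simplex J kappa !=set0.
Hypothesis kappa_gt0 : 0 < kappa.
Hypothesis kappa_le1 : kappa <= 1.
Hypothesis Jsym : forall e, e \in J -> - e \in J.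
Variable e0 : 'rV[int]_d.
Hypothesis e0J : e0 \in J.
Local Notation hull := (scaled_hull J (@embed R d)).
Local Notation direction := (direction (R := R) J).
Variable C : R.
Hypothesis C_gt0 : 0 < C.
Hypothesis gauge : forall x, hull (C * `|x|) x.
Variable L : nat -> 'rV[int]_d -> R.
Hypothesis L_bounds : forall k u, direction k u -> k%:R * ln kappa <= L k u <= 0.
Variable w : env_path ne.
Hypothesis w_grows : forall k u, direction k u -> grows (log_walk k u w) (L k u).
Local Notation walks := (g_sigma_algebraType (@walk_cylinders d)).
Variable P : probability walks R.
Hypothesis quenchedP : quenched_law w 0 P.

Let position_event (A : set 'rV[R]_d) n : set walks :=
  [set X | A (n%:R^-1 *: embed (X n))].

Let position_measurable A n : measurable (position_event A n).
Proof. exact: (@measurable_position d n (fun v => A (n%:R^-1 *: embed v))). Qed.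

Lemma log_prob_rate_ge (A : set 'rV[R]_d) n c : (0 < n)%N ->
  ((expR (c * n%:R))%:E <= P (position_event A n))%E ->
  (c%:E <= log_prob_rate P A n)%E.
Proof.
move=> n0; rewrite /log_prob_rate -/(position_event A n).
have n0' : 0 < n%:R :> R by rewrite ltr0n.
rewrite -(@fineK _ (P (position_event A n))) ?fin_num_measure// lee_fin => cx.
have x0 : 0 < fine (P (position_event A n)) by apply: lt_le_trans cx; exact: expR_gt0.
rewrite lne_EFin// -EFinM lee_fin ler_pdivlMl// mulrC.
by rewrite -ler_expR lnK.
Qed.

Lemma log_prob_rate_le (A : set 'rV[R]_d) n c : (0 < n)%N ->
  (P (position_event A n) <= (expR (c * n%:R))%:E)%E ->
  (log_prob_rate P A n <= c%:E)%E.
Proof.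
move=> n0; rewrite /log_prob_rate -/(position_event A n).
have n0' : 0 < n%:R :> R by rewrite ltr0n.
rewrite -(@fineK _ (P (position_event A n))) ?fin_num_measure// lee_fin => cx.
have [x0|x0] := leP (fine (P (position_event A n))) 0.
  by rewrite le0_lneNy ?lee_fin// gt0_muleNy ?lte_fin ?invr_gt0// leNye.
rewrite lne_EFin// -EFinM lee_fin ler_pdivrMl// mulrC.
by rewrite -ler_expR lnK.
Qed.

(** A general time is [j * k + m] with [m < k]: after [j] blocks the last [m] steps repeat [e0],
    with bounded cost and bounded displacement. Half of [e] pays for the fluctuation along the
    blocks, half for these last steps. *)
Lemma lower_velocity (A : set 'rV[R]_d) p e : direction p.1 p.2 ->
  nbhs (velocity p) A -> 0 < e ->
  exists N, forall n, (N <= n)%N ->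
    ((- velocity_rate L p - e)%:E <= log_prob_rate P A n)%E.
Proof.
case: p => k u /= D /nbhs_ballP[r /= r0 rA] e_gt0.
have [k0 uk _] := D; have /andP[_ L0] := L_bounds D.
have k0' : 0 < k%:R :> R by rewrite ltr0n.
have ek0 : 0 < e * k%:R / 2 by rewrite divr_gt0// mulr_gt0.
have [N1 H1] := w_grows D ek0.
have [N2 H2] := eventually_le_mulrn (- ln kappa) (divr_gt0 e_gt0 (ltr0n R 2)).
have [N3 H3] := eventually_le_mulrn
  (k%:R * `|embed e0 - velocity (k, u)| + 1) r0.
exists (maxn N1 N2 * k + N3).+1 => n Nn.
have n0 : (0 < n)%N by exact: leq_ltn_trans Nn.
have n0' : 0 < n%:R :> R by rewrite ltr0n.
pose j := (n %/ k)%N; pose m := (n %% k)%N.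
have nE : n = (j * k + m)%N by exact: divn_eq.
have mk : (m < k)%N by rewrite ltn_mod.
have Nj : (maxn N1 N2 <= j)%N.
  by rewrite leq_divRL//; apply: leq_trans (ltnW Nn); exact: leq_addr.
have {}H1 := H1 j (leq_trans (leq_maxl _ _) Nj).
have {}H2 := H2 j (leq_trans (leq_maxr _ _) Nj).
have {}H3 : k%:R * `|embed e0 - velocity (k, u)| + 1 <= r * n%:R.
  by apply: H3; apply: leq_trans (ltnW Nn); exact: leq_addl.
have em : e0 *+ m \in nstep J m.
  by rewrite -[X in nstep _ X]muln1; apply: nstepMn; rewrite nstep1.
pose v := u *+ j + e0 *+ m.
have vn : v \in nstep J n by rewrite nE; apply: nstepD => //; exact: nstepMn.
have mr : m%:R <= k%:R :> R by rewrite ler_nat ltnW.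
have nR : n%:R = j%:R * k%:R + m%:R :> R by rewrite {1}nE natrD natrM.
apply: log_prob_rate_ge => //.
have vA : A (n%:R^-1 *: embed v).
  apply: rA; rewrite -ball_normE /=.
  have -> : velocity (k, u) - n%:R^-1 *: embed v =
      (m%:R / n%:R) *: (velocity (k, u) - embed e0) :> 'rV[R]_d.
    have -> : embed v = (j%:R * k%:R) *: velocity (k, u) + m%:R *: embed e0 :> 'rV[R]_d.
      by rewrite embedD !embedMn /velocity scalerA mulfK ?gt_eqF.
    move: (velocity (k, u)) => x; apply/rowP => i; rewrite !mxE.
    by rewrite nR; field; rewrite -nR gt_eqF.
  rewrite normrZ distrC ger0_norm ?divr_ge0// mulrAC ltr_pdivrMr//.
  have : m%:R * `|embed e0 - velocity (k, u)| <= k%:R * `|embed e0 - velocity (k, u)| :> R.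
    exact: ler_wpM2r.
  lra.
apply: (@le_trans _ _ (walk_prob w n v)%:E); last first.
  apply: le_trans (walk_prob_le_quenched kappa_gt0 quenchedP n v) _.
  apply: le_measure; rewrite ?inE; [exact: measurable_site|exact: position_measurable|].
  by move=> X /= Xn; rewrite /position_event /= Xn.
rewrite lee_fin -[leRHS]lnK ?posrE ?walk_prob_gt0// ler_expR.
have := ln_walk_probD kappa_gt0 w (nstepMn j uk) em; rewrite -nE -/v.
apply: le_trans; have /andP[g1 _] := H1.
have g2 := ln_walk_prob_ge kappa_gt0 (env_shift_by (j * k) (u *+ j) w) em.
apply: le_trans (lerD g1 g2); rewrite /velocity_rate /= mulNr opprK nR.
have Lm : L k u / k%:R * m%:R <= 0.
  by rewrite mulr_le0_ge0// ler_pdivrMr// mul0r.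
have mK : - (m%:R * ln kappa) <= - (k%:R * ln kappa).
  by rewrite -!mulrN ler_wpM2r// oppr_ge0 ln_le0.
have H2' : - (k%:R * ln kappa) <= e * k%:R / 2 * j%:R.
  by rewrite -mulrN (mulrC e) -!mulrA ler_pM2l// mulrA.
have em0 : 0 <= e * m%:R by rewrite mulr_ge0// ltW.
have -> : (L k u / k%:R - e) * (j%:R * k%:R + m%:R) =
    L k u * j%:R + L k u / k%:R * m%:R - e * k%:R * j%:R - e * m%:R.
  by field; rewrite gt_eqF.
rewrite mulrBl; lra.
Qed.

Definition mass (A : set 'rV[R]_d) n : R :=
  \sum_(v <- nstep J n | `[< A (n%:R^-1 *: embed v) >]) walk_prob w n v.

Lemma mass_sub (A B : set 'rV[R]_d) n :
  (forall v, v \in nstep J n -> A (n%:R^-1 *: embed v) -> B (n%:R^-1 *: embed v)) ->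
  mass A n <= mass B n.
Proof.
move=> AB; rewrite /mass big_mkcond [leRHS]big_mkcond /=.
rewrite big_seq [leRHS]big_seq; apply: ler_sum => v vn.
case: asboolP => [/(AB v vn) Bv|_]; first by rewrite asboolT.
by case: ifP => // _; exact: walk_prob_ge0.
Qed.

Lemma massU A B n : mass (A `|` B) n <= mass A n + mass B n.
Proof.
rewrite /mass !(big_mkcond (fun v => `[< _ >])) /= -big_split /=.
apply: ler_sum => v _; have := walk_prob_ge0 kappa_gt0 w n v.
by case: asboolP => [[Av|Bv]|nAB]; do 2 (case: asboolP => ?); rewrite ?addr0 ?add0r//;
   move=> *; rewrite ?lerDl ?addr_ge0//; tauto.
Qed.

Lemma nstep_scaled_hull n v : (0 < n)%N -> v \in nstep J n ->
  hull 1 (n%:R^-1 *: embed v).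
Proof.
move=> n0 vn; have := shullZ _ (nstep_shull R vn).
by move=> /(_ n%:R^-1); rewrite mulVf ?pnatr_eq0 -?lt0n//; apply; rewrite invr_ge0.
Qed.

(* From any point reached at time n close to n x, the walk can still be steered to
   j u at time j k ~ (1 + s) n, at the cost of a factor kappa per step; this turns
   the mass of a ball into the probability of a single point. *)
Lemma mass_le_steered k u n j (A : set 'rV[R]_d) : (n <= j * k)%N -> u \in nstep J k ->
  (forall v, v \in nstep J n -> A (n%:R^-1 *: embed v) ->
     u *+ j - v \in nstep J (j * k - n)) ->
  mass A n <= expR (log_walk k u w j - ln kappa * (j * k - n)%:R).
Proof.
move=> njk uk steer; rewrite -(ler_pM2r (expR_gt0 (ln kappa * (j * k - n)%:R))).
rewrite -expRD subrK /log_walk lnK ?posrE ?walk_prob_gt0 ?nstepMn//.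
rewrite expRM_natr lnK// /mass -big_filter.
pose s := [seq v <- nstep J n | `[< A (n%:R^-1 *: embed v) >]].
have us : uniq s by rewrite filter_uniq// fset_uniq.
have := walk_prob_shift_le kappa_gt0 w n (j * k - n) (u *+ j) us.
rewrite subnKC//; apply: le_trans; rewrite mulr_suml big_seq [leRHS]big_seq.
apply: ler_sum => v; rewrite mem_filter => /andP[/asboolP Av vn].
by rewrite ler_wpM2l ?walk_prob_ge0// walk_prob_ge// steer.
Qed.

Lemma upper_local x a : 0 <= a -> (a%:E < rate J L x)%E ->
  exists r, 0 < r /\ exists N, forall n, (N <= n)%N ->
    mass (ball x r) n <= expR (- a * n%:R).
Proof.
move=> a0 /rate_gtP[r0 r0_gt0 ar].
have [hx|nx] := pselect (hull 1 x); last first.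
  have := closed_openC (@shull_closed d J R).
  rewrite openE => /(_ x nx)/nbhs_ballP[r /= r_gt0 h].
  exists r; split=> //; exists 1%N => n n1; rewrite /mass big_seq_cond big1 ?expR_ge0//.
  move=> v /andP[vn /asboolP xv].
  by exfalso; apply: (h _ xv); exact: nstep_scaled_hull.
have [b ab hb] : exists2 b, a < b & forall p, direction p.1 p.2 ->
    `|velocity p - x| < r0 -> b <= velocity_rate L p.
  have lb p : direction p.1 p.2 -> `|velocity p - x| < r0 ->
      (local_rate J L x r0 <= (velocity_rate L p)%:E)%E.
    by move=> Dp px; apply: ereal_inf_lbound; exists p.
  case E : (local_rate J L x r0) ar lb => [s| |] //.
    by rewrite lte_fin => as_ lb; exists s => // p Dp px; rewrite -lee_fin; exact: lb.
  move=> _ lb; exists (a + 1); first by rewrite ltrDl.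
  by move=> p Dp px; have := lb p Dp px; rewrite leye_eq.
pose K0 := - ln kappa.
have K00 : 0 <= K0 by rewrite oppr_ge0 ln_le0.
pose nx := `|x|; have nx0 : 0 <= nx := normr_ge0 x.
(* The fraction [s] of extra time is small enough that [x / (1 + s)] stays near [x], where rates are
   at least [b], and that steering costs at most half of [b - a]. *)
have [s [s0 s1 sx sK]] : exists s : R, [/\ 0 < s, s <= 1, s * nx < r0 / 2 & s * K0 <= (b - a) / 2].
  pose s1 := r0 / (2 * (nx + 1)); pose s2 := (b - a) / (2 * (K0 + 1)).
  have s1_gt0 : 0 < s1 by rewrite divr_gt0// mulr_gt0// ltr_wpDl.
  have s2_gt0 : 0 < s2 by rewrite divr_gt0 ?subr_gt0// mulr_gt0// ltr_wpDl.
  exists (Num.min 1 (Num.min s1 s2)); split.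
  - by rewrite !lt_min ltr01 s1_gt0.
  - by rewrite ge_min lexx.
  - apply: (@le_lt_trans _ _ (s1 * nx)).
      by rewrite ler_wpM2r// !ge_min lexx orbT.
    rewrite /s1 invfM mulrA -mulrA gtr_pMr ?divr_gt0//.
    by rewrite mulrC ltr_pdivrMr ?ltr_wpDl// mul1r ltrDl.
  - apply: (@le_trans _ _ (s2 * K0)).
      by rewrite ler_wpM2r// !ge_min lexx !orbT.
    rewrite /s2 invfM mulrA -mulrA ger_pMr ?divr_gt0 ?subr_gt0//.
    by rewrite mulrC ler_pdivrMr ?ltr_wpDl// mul1r lerDl.
(* The displacement left to steer is about [3 * n * q], so its gauge uses three eighths of the
   reserve [s * n]; bounded terms use at most half of it. *)
have [q [q0 qr qC]] : exists q : R, [/\ 0 < q, q <= r0 / 2 & C * q <= s / 8].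
  have q2 : 0 < s / 8 / C by rewrite !divr_gt0.
  exists (Num.min (r0 / 2) (s / 8 / C)); split.
  - by rewrite lt_min divr_gt0.
  - by rewrite ge_min lexx.
  - by rewrite mulrC -ler_pdivlMr// ge_min lexx orbT.
have s1p : 0 < 1 + s by rewrite addr_gt0.
have si1 : (1 + s)^-1 <= 1 by rewrite invf_le1// lerDl ltW.
have hx' : hull 1 ((1 + s)^-1 *: x).
  apply: (@shull_le _ _ _ _ _ ((1 + s)^-1 * 1)); first by rewrite mulr1.
  by apply: shullZ hx; rewrite invr_ge0 ltW.
have [[k u] [/= D px]] := direction_dense Jsym e0J C_gt0 gauge hx' q0.
have vx : `|velocity (k, u) - x| < r0.
  rewrite -(subrKA ((1 + s)^-1 *: x)); apply: le_lt_trans (ler_normD _ _) _.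
  rewrite (splitr r0) ltr_leD//; first exact: lt_le_trans qr.
  have -> : (1 + s)^-1 *: x - x = (- (s * (1 + s)^-1)) *: x.
    by apply/rowP => i; rewrite !mxE; field; rewrite gt_eqF.
  rewrite normrZ normrN ger0_norm ?divr_ge0 ?(ltW s0) ?(ltW s1p)//.
  apply: le_trans (ltW sx); rewrite ler_wpM2r// ler_piMr// ltW//.
have [k0 uk _] := D.
have k0' : 0 < k%:R :> R by rewrite ltr0n.
have Lb : L k u <= - b * k%:R.
  by have := hb (k, u) D vx; rewrite /velocity_rate /= ler_pdivlMr// mulNr lerNr.
have e'0 : 0 < k%:R * (b - a) / 4 by rewrite divr_gt0// mulr_gt0// subr_gt0.
have [N1 H1] := w_grows D e'0.
have [K HK] := nstep_control Jsym e0J (R := R).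
have [N2 H2] := eventually_le_mulrn (C * (k%:R * q + k%:R * nx) + K%:R)
  (divr_gt0 s0 (ltr0n R 2)).
have ba4 : 0 < (b - a) / 4 by rewrite divr_gt0// subr_gt0.
have [N3 H3] := eventually_le_mulrn (k%:R * K0) ba4.
exists q; split=> //; exists (N1 * k + N2 + N3).+1 => n Nn.
have n0 : (0 < n)%N by exact: leq_ltn_trans Nn.
have n0' : 0 < n%:R :> R by rewrite ltr0n.
have {}H2 := H2 n (leq_trans (leq_trans (leq_addl _ _) (leq_addr _ _)) (ltnW Nn)).
have {}H3 := H3 n (leq_trans (leq_addl _ _) (ltnW Nn)).
(* The least [j] with [j * k] beyond [(1 + s) * n]; as [u / k] is near [x / (1 + s)], the point
   [j u] is near [n x]. *)
pose j := (Num.truncn ((1 + s) * n%:R / k%:R)).+1.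
have /truncn_itv/andP[jl ju] : 0 <= (1 + s) * n%:R / k%:R.
  by rewrite divr_ge0 ?mulr_ge0 ?(ltW s1p).
rewrite -/j ltr_pdivrMr// in ju; rewrite ler_pdivlMr// in jl.
have {}jl : j%:R * k%:R <= (1 + s) * n%:R + k%:R.
  by rewrite /j -natr1 mulrDl mul1r lerD2r.
have sn0 : 0 < s * n%:R by rewrite mulr_gt0.
have sn1 : s * n%:R <= n%:R by rewrite ler_piMl.
have njk' : n%:R <= j%:R * k%:R :> R by move: ju; rewrite mulrDl mul1r; lra.
have njk : (n <= j * k)%N by rewrite -(ler_nat R) natrM.
have {}H1 := H1 j.
have N1j : (N1 <= j)%N.
  rewrite -(leq_pmul2r k0); apply: leq_trans njk; apply: leq_trans (ltnW Nn).
  by rewrite -addnA leq_addr.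
have /andP[_ {}H1] := H1 N1j.
apply: le_trans (mass_le_steered njk uk _) _.
- move=> v vn; rewrite -ball_normE /= => xv.
  apply: (HK _ _ (C * `|embed (u *+ j - v)|)); last 2 first.
  + exact: gauge.
  + have d1 : `|embed (u *+ j - v) : 'rV[R]_d| <=
        j%:R * k%:R * q + k%:R * nx + n%:R * q.
      have -> : embed (u *+ j - v) =
          (j%:R * k%:R) *: (velocity (k, u) - (1 + s)^-1 *: x) +
          (j%:R * k%:R / (1 + s) - n%:R) *: x + n%:R *: (x - n%:R^-1 *: embed v) :> 'rV[R]_d.
        rewrite embedB embedMn /velocity /=; move: (embed u) (embed v) => y z.
        apply/rowP => i; rewrite !mxE; field.
        by rewrite !gt_eqF.
      apply: le_trans (ler_normD _ _) _; apply: lerD; last first.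
        by rewrite normrZ ger0_norm// ler_wpM2l// ltW.
      apply: le_trans (ler_normD _ _) _; apply: lerD.
        by rewrite normrZ ger0_norm ?mulr_ge0// ler_wpM2l ?mulr_ge0// ltW.
      rewrite normrZ ler_wpM2r// ger0_norm; last first.
        by rewrite subr_ge0 ler_pdivlMr// mulrC ltW.
      rewrite lerBlDr ler_pdivrMr//; apply: le_trans jl _.
      by have := mulr_ge0 (ltW k0') (ltW s0); rewrite mulrDl mulrDr; lra.
    rewrite natrB// natrM.
    have d2 : C * `|embed (u *+ j - v) : 'rV[R]_d| <=
        C * (j%:R * k%:R * q + k%:R * nx + n%:R * q) by rewrite ler_pM2l.
    have d3 : (C * q) * (j%:R * k%:R) <= (C * q) * (2 * n%:R + k%:R).
      by rewrite ler_wpM2l ?mulr_ge0 ?(ltW C_gt0) ?(ltW q0)//; move: jl; rewrite mulrDl mul1r; lra.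
    have d4 : (C * q) * n%:R <= s / 8 * n%:R by rewrite ler_wpM2r.
    move: ju; rewrite mulrDl mul1r => ju.
    move: d2 d3 d4 H2; rewrite !mulrDr => d2 d3 d4 H2.
    have e1 : C * (j%:R * k%:R * q) = C * q * (j%:R * k%:R) by ring.
    have e2 : C * (n%:R * q) = C * q * n%:R by ring.
    have e3 : C * q * (2 * n%:R) = 2 * (C * q * n%:R) by ring.
    have e4 : C * (k%:R * q) = C * q * k%:R by ring.
    rewrite e1 e2 in d2; rewrite e3 in d3; rewrite e4 in H2.
    lra.
  + exists (j * k + n)%N; split.
      by apply: nstepD; [exact: nstepMn|exact: nstepN].
    by rewrite oddD oddB.
(* Of the gap [b - a], one quarter covers fluctuations of [log_walk], one half the steering over
   [s * n] steps, and one quarter the rounding by at most [k] steps. Replacing [j * k] by [n] uses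
   [0 <= a]. *)
- rewrite ler_expR natrB// natrM.
  have c1 : K0 * (j%:R * k%:R - n%:R) <= K0 * (s * n%:R + k%:R).
    by rewrite ler_wpM2l//; move: jl; rewrite mulrDl mul1r; lra.
  have c2 : (s * K0) * n%:R <= (b - a) / 2 * n%:R by rewrite ler_wpM2r.
  have c3 : (3 * b + a) / 4 * n%:R <= (3 * b + a) / 4 * (j%:R * k%:R).
    by rewrite ler_wpM2l// divr_ge0//; lra.
  have c4 : (L k u + k%:R * (b - a) / 4) * j%:R <= - ((3 * b + a) / 4 * (j%:R * k%:R)).
    have -> : - ((3 * b + a) / 4 * (j%:R * k%:R)) =
        (- b * k%:R + k%:R * (b - a) / 4) * j%:R by field.
    by rewrite ler_wpM2r// lerD2r.
  have c5 := le_trans H1 c4.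
  have -> : ln kappa * (j%:R * k%:R - n%:R) = - (K0 * (j%:R * k%:R - n%:R)).
    by rewrite /K0 mulNr opprK.
  have e1 : K0 * (s * n%:R + k%:R) = s * K0 * n%:R + k%:R * K0 by ring.
  rewrite e1 in c1.
  have e2 : (3 * b + a) / 4 * n%:R = a * n%:R + 3 * ((b - a) / 4 * n%:R) by field.
  have e3 : (b - a) / 2 * n%:R = 2 * ((b - a) / 4 * n%:R) by field.
  rewrite e2 in c3; rewrite e3 in c2.
  move: c1 c2 c3 c5 H3; move: (log_walk k u w j) (K0 * _) (s * K0 * _) (_ / 4 * (_ * _))
    ((b - a) / 4 * _) (k%:R * K0) => t1 t2 t3 t4 t5 t6; rewrite mulNr; lra.
Qed.

End ldp_bounds.

(** * From local estimates to open and closed sets *)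

Section limit_bounds.
Context {R : realType}.
Local Open Scope ereal_scope.

Lemma limn_esup_le (u : nat -> \bar R) c :
  (exists N, forall n, (N <= n)%N -> u n <= c) -> limn_esup u <= c.
Proof.
move=> [N uc]; rewrite limn_esup_lim; apply: lime_le; first exact: is_cvg_esups.
exists N => // n /= Nn; apply: ge_ereal_sup => _ [m /= nm <-].
by apply: uc; exact: leq_trans nm.
Qed.

Lemma limn_einf_ge (u : nat -> \bar R) c :
  (exists N, forall n, (N <= n)%N -> c <= u n) -> c <= limn_einf u.
Proof.
move=> [N uc]; rewrite limn_einf_lim; apply: lime_ge; first exact: is_cvg_einfs.
exists N => // n /= Nn; apply: le_ereal_inf_tmp => _ [m /= nm <-].
by apply: uc; exact: leq_trans nm.
Qed.

End limit_bounds.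

Section large_deviations.
Context {R : realType} {d : nat} (J : {fset 'rV[int]_d}) (kappa : R).
Variable ne : elliptic_simplex J kappa !=set0.
Hypothesis kappa_gt0 : 0 < kappa.
Hypothesis kappa_le1 : kappa <= 1.
Hypothesis Jsym : forall e, e \in J -> - e \in J.
Variable e0 : 'rV[int]_d.
Hypothesis e0J : e0 \in J.
Local Notation hull := (scaled_hull J (@embed R d)).
Local Notation direction := (direction (R := R) J).
Variable C : R.
Hypothesis C_gt0 : 0 < C.
Hypothesis gauge : forall x, hull (C * `|x|) x.
Variable L : nat -> 'rV[int]_d -> R.
Hypothesis L_bounds : forall k u, direction k u -> k%:R * ln kappa <= L k u <= 0.
Variable w : env_path ne.
Hypothesis w_grows : forall k u, direction k u -> grows (log_walk k u w) (L k u).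
Local Notation walks := (g_sigma_algebraType (@walk_cylinders d)).
Variable P : probability walks R.
Hypothesis quenchedP : quenched_law w 0 P.
Local Notation mass := (mass w).

(** The prefactor [M] makes the property stable under finite unions; it disappears on the
    exponential scale. *)
Definition light (a : R) (A : set 'rV[R]_d) :=
  exists M N, 0 <= M /\ forall n, (N <= n)%N -> mass A n <= M * expR (- a * n%:R).

Lemma lightU a A B : light a A -> light a B -> light a (A `|` B).
Proof.
move=> [M1 [N1 [M10 h1]]] [M2 [N2 [M20 h2]]].
exists (M1 + M2), (maxn N1 N2); split; first exact: addr_ge0.
move=> n; rewrite geq_max => /andP[n1 n2].
apply: le_trans (massU kappa_gt0 _ _ _ _) _.
by rewrite mulrDl lerD ?h1 ?h2.
Qed.

Lemma light_sub a A B : A `<=` B -> light a B -> light a A.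
Proof.
move=> AB [M [N [M0 h]]]; exists M, N; split => // n Nn.
by apply: le_trans (h n Nn); apply: mass_sub => // v _; exact: AB.
Qed.

Lemma light_set0 a : light a set0.
Proof.
exists 0, 0%N; split => // n _; rewrite mul0r.
have -> : mass set0 n = \sum_(v <- nstep J n | false) walk_prob w n v.
  by apply: eq_bigl => v; apply/asboolP.
by rewrite big_pred0_eq.
Qed.

(** If [K] were not light, the sets with light complement in [K] would form a proper filter, and a
    cluster point of it would contradict the local hypothesis. *)
Lemma light_compact a (K : set 'rV[R]_d) : compact K ->
  (forall x, K x -> exists r, 0 < r /\ light a (ball x r)) -> light a K.
Proof.
move=> cK locK; apply: contrapT => nK.
pose F : set_system 'rV[R]_d := fun B => light a (K `\` B).
have FF : ProperFilter F.
  split; first by rewrite /F setD0.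
  split.
  - by rewrite /F setDT; exact: light_set0.
  - by move=> A B FA FB; rewrite /F setDIr; exact: lightU.
  - by move=> A B AB; apply: light_sub; exact: setDS.
have FK : F K by rewrite /F setDv; exact: light_set0.
have [x [Kx cx]] := cK F FF FK.
have [r [r0 lr]] := locK x Kx.
have FB : F (~` ball x r).
  by apply: light_sub lr => y [_ /contrapT].
by have [y [nb yb]] := cx _ _ FB (nbhsx_ballx x r r0).
Qed.

Lemma upper_bound_real (A : set 'rV[R]_d) a e : closed A -> 0 <= a -> 0 < e ->
  (a%:E < ereal_inf (rate J L @` A))%E ->
  exists N, forall n, (N <= n)%N -> (log_prob_rate P A n <= (- a + e)%:E)%E.
Proof.
move=> cA a0 e_gt0 aA.
(* The rescaled walk never leaves the compact hull, so exponential tightness is automatic. *)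
have cK : compact (A `&` hull 1).
  rewrite setIC; apply: compact_closedI => //.
  by apply: shull_compact; exact: fset_uniq.
have [|M [N [M0 hM]]] := @light_compact a _ cK.
  move=> x [Ax _].
  have ax : (a%:E < rate J L x)%E.
    by apply: lt_le_trans aA _; apply: ereal_inf_lbound; exists x.
  have [r [r0 [N hN]]] :=
    upper_local kappa_gt0 kappa_le1 Jsym e0J C_gt0 gauge w_grows a0 ax.
  by exists r; split=> //; exists 1, N; split => // n Nn; rewrite mul1r; exact: hN.
have [N' hN'] := eventually_le_mulrn M e_gt0.
exists (maxn N N').+1 => n Nn.
have n0 : (0 < n)%N by exact: leq_ltn_trans Nn.
have {}hM := hM n (leq_trans (leq_maxl _ _) (ltnW Nn)).
have {}hN' := hN' n (leq_trans (leq_maxr _ _) (ltnW Nn)).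
apply: log_prob_rate_le => //.
apply: le_trans (quenched_position_le kappa_gt0 quenchedP n
  (fun v => A (n%:R^-1 *: embed v))) _.
rewrite lee_fin; apply: (@le_trans _ _ (mass (A `&` hull 1) n)).
  apply: (mass_sub kappa_gt0) => v vn Av; split => //.
  exact: nstep_scaled_hull.
apply: le_trans hM _; rewrite mulrDl expRD mulrC ler_wpM2l ?expR_ge0//.
apply: le_trans hN' _; apply: le_trans (expR_ge1Dx _).
by rewrite lerDr.
Qed.

Lemma upper_bound (A : set 'rV[R]_d) : closed A ->
  (limn_esup (log_prob_rate P A) <= - ereal_inf (rate J L @` A))%E.
Proof.
move=> cA; set m := ereal_inf _; set l := limn_esup _.
have l0 : (l <= 0)%E.
  apply: limn_esup_le; exists 1%N => n n1; apply: log_prob_rate_le => //.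
  by rewrite mul0r expR0; apply: probability_le1; exact: (@measurable_position d n
    (fun v => A (n%:R^-1 *: embed v))).
have la a : (a%:E < m)%E -> (l <= (- a)%:E)%E.
  move=> am; have [a0|a0] := leP 0 a; last first.
    by apply: le_trans l0 _; rewrite lee_fin oppr_ge0 ltW.
  apply/lee_addgt0Pr => e e_gt0; rewrite -EFinD; apply: limn_esup_le.
  exact: upper_bound_real.
case: m la => [s| |] la; last by rewrite leey.
- rewrite -EFinN; apply/lee_addgt0Pr => e e_gt0; rewrite -EFinD addrC -opprB.
  by apply: la; rewrite lte_fin ltrBlDr ltrDl.
- rewrite leeNr leye_eq; apply/eqP/eqyP => a _.
  by rewrite leeNr; apply: la; rewrite ltry.
Qed.

Lemma lower_bound (A : set 'rV[R]_d) : open A ->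
  (- ereal_inf (rate J L @` A) <= limn_einf (log_prob_rate P A))%E.
Proof.
move=> oA; rewrite leeNl; apply: le_ereal_inf_tmp => _ [x Ax <-].
rewrite leeNl; set l := limn_einf _.
case E : (rate J L x) => [s| |]; first last.
- by have := rate_ge0 kappa_le1 L_bounds x; rewrite E.
- by rewrite leNye.
rewrite -EFinN; apply/lee_subgt0Pr => e e_gt0; rewrite -EFinB.
have /nbhs_ballP[r /= r0 rA] : nbhs x A by exact: open_nbhs_nbhs.
have e2 : 0 < e / 2 by rewrite divr_gt0.
have /rate_leP/(_ _ _ r0 e2)[p [Dp px ps]] : (rate J L x <= s%:E)%E by rewrite E.
have pA : nbhs (velocity p) A.
  by apply: open_nbhs_nbhs; split => //; apply: rA; rewrite -ball_normE /= distrC.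
have [N hN] := lower_velocity kappa_gt0 kappa_le1 e0J L_bounds w_grows quenchedP Dp pA e2.
apply: limn_einf_ge; exists N => n Nn; apply: le_trans (hN n Nn).
by rewrite lee_fin; move: ps; move: (velocity_rate L p) => c; lra.
Qed.

End large_deviations.

Lemma elliptic_le1 (R : realType) (d : nat) (J : {fset 'rV[int]_d}) (kappa : R) e :
  0 < kappa -> elliptic_simplex J kappa !=set0 -> e \in J -> kappa <= 1.
Proof.
move=> kappa_gt0 [v [vk v1]] eJ; apply: le_trans (vk (FSetSub eJ)) _.
rewrite -v1 (bigD1 (FSetSub eJ))//= lerDl.
by apply: sumr_ge0 => e' _; apply: le_trans (vk e'); exact: ltW.
Qed.

Lemma convex_hull0 (R : realType) (d : nat) : @convex_hull R d set0 = set0.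
Proof.
by apply/seteqP; split => // x; apply; split => // y z t; rewrite inE.
Qed.

Lemma jump_range_geometry (R : realType) (d : nat) (J : {fset 'rV[int]_d}) : (0 < d)%N ->
  [/\ lattice_convex (R := R) [set` J], lattice_symmetric [set` J] &
      nbhs (0 : 'rV[R]_d) (convex_hull (embed @` [set` J]))] \/ nearest_neighbor J ->
  [/\ forall e, e \in J -> - e \in J, exists e0, e0 \in J &
    exists2 C : R, 0 < C & forall x, scaled_hull J (@embed R d) (C * `|x|) x].
Proof.
move=> d0 [[_ symJ hullJ]|nnJ].
  have Jsym e : e \in J -> - e \in J.
    move=> eJ; have : [set` J] e by [].
    by rewrite symJ => -[z zJ <-]; rewrite opprK.
  (* A neighbourhood of the origin is nonempty, whereas the hull of the empty set is empty. *)
  have [e0 e0J] : exists e0, e0 \in J.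
    apply: contrapT => nJ; have J0 : [set` J] = set0.
      by apply/seteqP; split => // e /= eJ; apply: nJ; exists e.
    by have := nbhs_singleton hullJ; rewrite J0 image_set0 convex_hull0.
  split => //; first by exists e0.
  by apply: gauge_of_nbhs; rewrite -(convex_hullE Jsym e0J).
split.
- move=> e; rewrite !nnJ => /eqP <-; apply/eqP.
  by apply: eq_bigr => i _; rewrite mxE normrN.
- exists (delta_mx ord0 (Ordinal d0)); rewrite nnJ (bigD1 (Ordinal d0))//= !mxE !eqxx.
  by rewrite big1 ?addr0// => i /negbTE i0; rewrite mxE i0 andbF normr0.
- exact: gauge_nearest_neighbor.
Qed.

Theorem theorem1p2 (R : realType) (d : nat) (hd : (0 < d)%N)
    (kappa : R) (hkappa : 0 < kappa) (J : {fset 'rV[int]_d})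
    (ne : elliptic_simplex J kappa !=set0)
    (p : R.-pker (borelType (env ne)) ~> (borelType (env ne)))
    (Q : R.-pker (borelType (env ne)) ~> (borelType (env_path ne)))
    (hQ : markov_laws p Q)
    (mu : probability (borelType (env ne)) R)
    (hinv : invariant_law Q mu) (htrans : translation_invariant mu)
    (hED : ergodic_shifts (annealed mu Q))
    (P : 'rV[int]_d -> env_path ne ->
         probability (g_sigma_algebraType (@walk_cylinders d)) R)
    (hP : forall x w, quenched_law w x (P x w))
    (hJ : [/\ lattice_convex (R := R) [set` J], lattice_symmetric [set` J] &
              nbhs (0 : 'rV[R]_d) (convex_hull (embed @` [set` J]))]
          \/ nearest_neighbor J) :
  let U : set 'rV[R]_d := limit_shape J in
  U = convex_hull (embed @` [set` J]) /\
  exists I : 'rV[R]_d -> \bar R,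
    [/\ convex_rate_function I,
        [/\ (forall x, U x -> (I x <= `|ln kappa|%:E)%E),
            (forall x, ~ U x -> I x = +oo%E) &
            (forall x, U° x -> {for x, continuous I})],
        (forall O : set 'rV[R]_d, open O ->
           {ae annealed mu Q, forall w : env_path ne,
             (- ereal_inf (I @` O) <= limn_einf (log_prob_rate (P 0%R w) O))%E}) &
        (forall C : set 'rV[R]_d, closed C ->
           {ae annealed mu Q, forall w : env_path ne,
             (limn_esup (log_prob_rate (P 0%R w) C) <= - ereal_inf (I @` C))%E})].
Proof.
have [Jsym [e0 e0J] [C C_gt0 gauge]] := jump_range_geometry hd hJ.
have kappa_le1 := elliptic_le1 hkappa ne e0J.
have [L [Lb Ls Lae]] := directional_rates hkappa kappa_le1 Jsym e0J hED.
move=> U; have UE : U = scaled_hull J (@embed R d) 1 by exact: limit_shapeE Jsym e0 e0J R.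
split; first by rewrite UE (convex_hullE Jsym e0J).
exists (rate J L); rewrite UE; split.
- split.
  + move=> x; exact: (rate_ge0 kappa_le1 Lb x).
  + exact: rate_lower_semicontinuous.
  + move=> x y t; exact: (rate_convex kappa_le1 Lb Ls x y).
- split.
  + move=> x; exact: (rate_le_hull kappa_le1 Jsym e0J C_gt0 gauge Lb).
  + move=> x; exact: (rate_notin_hull kappa_le1 Lb).
  + move=> x; exact: (rate_continuous kappa_le1 Jsym e0J C_gt0 gauge Lb Ls).
(* The null set is that of [Lae], chosen before the open or closed set. *)
- move=> O oO; apply: aeS Lae => w wg.
  exact: (lower_bound hkappa kappa_le1 e0J Lb wg (hP 0 w) oO).
- move=> A cA; apply: aeS Lae => w wg.
  exact: (upper_bound hkappa kappa_le1 Jsym e0J C_gt0 gauge wg (hP 0 w) cA).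
Qed.
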